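(* Let $\varepsilon=1/N$, $x=yN$ and $n=N-j$ with $j\in\mathbb{Z}$, $j\ge-1$. For $n\approx N$ (that is, $n/N=1-O(\varepsilon)$), $0<y<1$ and $y\not\approx q$, as $N\to\infty$, $$K_n(x)\sim\binom{N}{j}(-p)^{N-j}\left(\frac{q}{p}\right)^{Ny}\cos(N\pi y)\left(1-\frac{y}{q}\right)^{j}+\binom{Ny}{N-j}\left(\frac{1-y}{q-y}\right)^{j+1}.$$
   Context: Fix real $0<p,q<1$ with $p+q=1$. For integers $n,N\ge 0$ and real $x$, the Krawtchouk polynomial is $$K_n(x)=K_n(x,N,p,q)=\sum_{k=0}^{n}\binom{x}{k}\binom{N-x}{n-k}q^{k}(-p)^{n-k},$$ where $\binom{a}{k}=a(a-1)\cdots(a-k+1)/k!$ for real $a$ and integer $k\geq 0$, and $\binom{N}{-1}=0$. The condition $y\not\approx q$ means that $y$ is not close to $q$.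
   Formalization: ''∼'' is read as K_n(x) = T1(1+o(1)) + T2(1+o(1)) for the two terms on the right, uniformly for y in compact parts of (0,1) with |y−q| bounded below; the limit K_n/(T1+T2) → 1 is false near zeros of T1+T2, where the terms cancel. *)

(* Defs.v *)
From HB Require Import structures.
From mathcomp Require Import all_boot all_order all_algebra.
From mathcomp Require Import all_classical all_reals all_analysis.

Set Implicit Arguments.
Unset Strict Implicit.
Unset Printing Implicit Defensive.

Import Order.TTheory GRing.Theory Num.Theory.

Local Open Scope ring_scope.

(* Generalized binomial coefficient with real upper argument. The lower
   argument is an integer so that binomR N (-1) = 0 is meaningful. *)
Definition binomR (R : realType) (a : R) (k : int) : R :=
  match k with
  | Posz m => (\prod_(i < m) (a - i%:R)) / (m`!)%:R
  | Negz _ => 0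
  end.

Definition krawtchouk (R : realType) (p q : R) (N n : nat) (x : R) : R :=
  \sum_(k < n.+1)
    binomR x k * binomR (N%:R - x) (n - k)%N * q ^+ k * (- p) ^+ (n - k).

(* f = g1 (1 + d1) + g2 (1 + d2) with relative errors d1, d2 of size at most e.
   As e tends to 0 this is the meaning of "f ~ g1 + g2" for a two-term
   oscillatory approximation, in which each term is given to leading order.
   It is not f / (g1 + g2) -> 1: the sum g1 + g2 may vanish by cancellation,
   at points other than the zeros of f. *)
Definition approx_sum (R : realType) (e f g1 g2 : R) : Prop :=
  exists d1 d2 : R, [/\ `|d1| <= e, `|d2| <= e
    & f = g1 * (1 + d1) + g2 * (1 + d2)].

(* Main.v *)
Require Import Defs.
From HB Require Import structures.
From mathcomp Require Import all_boot all_order all_algebra.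
From mathcomp Require Import all_classical all_reals all_analysis.
From mathcomp Require Import ring lra zify.

Import Order.TTheory GRing.Theory Num.Theory.
Import numFieldNormedType.Exports.

Local Open Scope classical_set_scope.
Local Open Scope ring_scope.

(** Write x = yN, c = y - q, and let m be an integer nearest to x, theta = x - m.

As a function of x, K_(N-j) is a polynomial of degree at most N, so it is
recovered by Lagrange interpolation from its values at 0, .., N.  Those values
are q^k (-p)^(N-k) s(k), where s = [dualK] is the dual Krawtchouk polynomial of
degree j; the dual polynomials are orthogonal for the binomial law
b(k) = C(N,k) q^k p^(N-k).  Separating the node m from the others ([krawtchouk_decomposition]) gives, for j >= 0,
    K_(N-j)(x) = K_(N-j)(m) l_m(x)
                 + C(x, N+1) (N+1) sum_(k <> m) b(k) s(k) / (x - k),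
where l_m is the basis polynomial of the node m.  The first summand is the
oscillating term, the second one the term with C(Ny, N-j); for j = -1 the
identity K_(N+1)(x) = C(x, N+1) is exact ([krawtchouk_above_degree]).

The sums over k <> m.  Multiplying by x - Nq and using the three-term recurrence
of the dual polynomials in their index, one finds a recurrence in i for the
normalised sums V_i: N c V_(i+1) equals N V_i plus a combination of V_i, V_(i+1)
and V_(i+2) with bounded coefficients, and V_0 = 1; the only error is a multiple
of b(m), smaller than every power of N since m/N stays away from q.  This gains
a factor 1/N at the price of one step in i, so the crude bound
V_i = O(N^((i+1)/2)), which comes from the moments of the binomial law, improves
itself to V_i = c^(-i) (1 + O(1/N)) ([bootstrap], [restsum_asymptotics]).  Since
C(x, N+1) = (y - 1)^(j+1) C(x, N-j) (1 + O(1/N)), this yields the second term.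

The node m.  The same recurrence, read at k = m where m - Nq is of order N,
gives s(m) = C(N,j) (c/(pq))^j (1 + O(1/N)) ([dualK_asymptotics]).  It remains
to replace l_m(x) by (q/p)^theta cos(pi theta).  If |theta| <= N^(-2), both are
close to 1.  Otherwise the node contributes only a negligible part of the other
term: C(x, N+1) equals theta l_m(x) / ((N+1) C(N,m)) in absolute value
([binomR_node]), l_m(x) is bounded below by (N+1)^(-2)
([lagrangeR_node_lower]), and b(m) beats all powers of N.  This is where it
matters that the two relative errors are separate: near the zeros of
C(Ny, N-j) the two terms may have any ratio.

All estimates are uniform in y, which is organised by the filter [uniformly] on
pairs (N, y) and by orders of growth in the square root of N. *)

Arguments binomR : simpl never.

(** * Krawtchouk polynomials at integer arguments *)

Section IntegerArguments.
Context {R : realType}.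
Implicit Types (p q : R) (k l n N : nat).

(** Generating polynomial of the Krawtchouk polynomials at the integer k, with
l = N - k. *)
Definition genpoly p q k l : {poly R} :=
  (1 + q *: 'X) ^+ k * (1 - p *: 'X) ^+ l.

Lemma deriv_linear_exp (a : R) k :
  (1 + a *: 'X) * ((1 + a *: 'X) ^+ k)^`() =
  (k%:R * a) *: (1 + a *: 'X) ^+ k.
Proof.
rewrite deriv_exp derivD derivC derivZ derivX add0r.
case: k => [|k]; first by rewrite mulr0n mulr0 mul0r scale0r.
rewrite -pred_Sn exprS -scaler_nat -!mul_polyC !polyCM polyC_natr; ring.
Qed.

(** First-order differential equation of (1 + qX)^k (1 - pX)^l, cleared of
denominators; reading off coefficients gives the three-term recurrence. *)
Lemma genpoly_ode p q k l :
  (1 + q *: 'X) * (1 - p *: 'X) * (genpoly p q k l)^`() =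
  ((k%:R * q - l%:R * p)%:P - ((k + l)%:R * p * q) *: 'X) * genpoly p q k l.
Proof.
have hk := deriv_linear_exp q k.
have hl : (1 - p *: 'X) * ((1 - p *: 'X) ^+ l)^`() =
    - (l%:R * p) *: (1 - p *: 'X) ^+ l.
  by have := deriv_linear_exp (- p) l; rewrite scaleNr mulrN.
rewrite /genpoly derivM.
transitivity ((1 - p *: 'X) * (1 - p *: 'X) ^+ l *
     ((1 + q *: 'X) * ((1 + q *: 'X) ^+ k)^`()) +
   (1 + q *: 'X) * (1 + q *: 'X) ^+ k *
     ((1 - p *: 'X) * ((1 - p *: 'X) ^+ l)^`())); first by ring.
rewrite hk hl -!mul_polyC.
rewrite natrD !(polyCM, polyCD, polyCN, polyC_natr); ring.
Qed.

Lemma genpoly_coef_rec p q k l n :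
  n.+2%:R * (genpoly p q k l)`_n.+2
    + (q - p) * n.+1%:R * (genpoly p q k l)`_n.+1
    - p * q * n%:R * (genpoly p q k l)`_n
  = (k%:R * q - l%:R * p) * (genpoly p q k l)`_n.+1
    - (k + l)%:R * p * q * (genpoly p q k l)`_n.
Proof.
have := congr1 (fun P : {poly R} => P`_n.+1) (genpoly_ode p q k l).
set P := genpoly _ _ _ _ => h.
have el : (1 + q *: 'X) * (1 - p *: 'X) * P^`() =
   P^`() + ((q - p) *: P^`() - (p * q) *: (P^`() * 'X)) * 'X.
  rewrite -!mul_polyC !(polyCM, polyCD, polyCN); ring.
have er : ((k%:R * q - l%:R * p)%:P - ((k + l)%:R * p * q) *: 'X) * P =
   (k%:R * q - l%:R * p) *: P - ((k + l)%:R * p * q) *: (P * 'X).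
  rewrite -!mul_polyC; ring.
move: h; rewrite /= el er !(coefD, coefMX, coefN, coefZ) /= !coef_deriv.
case: n => [|n] /=; rewrite -!(mulr_natr P`_(_)) => <-; first by ring.
by move: P`_n.+3 P`_n.+2 P`_n.+1 => u v w; ring.
Qed.

Lemma coef_linear_exp (a : R) k n :
  ((1 + a *: 'X) ^+ k : {poly R})`_n = 'C(k, n)%:R * a ^+ n.
Proof.
rewrite exprDn coef_sum.
under eq_bigr do rewrite expr1n mul1r exprZn coefMn coefZ coefXn.
case: (ltnP n k.+1) => hn.
  rewrite (bigD1 (Ordinal hn)) //= eqxx big1 ?addr0; first by rewrite mulr1 mulr_natl.
  move=> i /negPf hi; rewrite (_ : (n == i) = false) ?mulr0 ?mul0rn //.
  by apply: contraFF hi => /eqP ni; apply/eqP/val_inj.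
rewrite bin_small // mul0r big1 // => i _.
rewrite (_ : (n == i) = false) ?mulr0 ?mul0rn //.
by apply/negbTE; rewrite gtn_eqF // (leq_trans (ltn_ord i)).
Qed.

Lemma size_genpoly_le p q k l : (size (genpoly p q k l) <= (k + l).+1)%N.
Proof.
have s1 (a : R) i : (size ((1 + a *: 'X) ^+ i : {poly R}) <= i.+1)%N.
  by apply/leq_sizeP => j hj; rewrite coef_linear_exp bin_small ?mul0r.
have := s1 (- p) l; rewrite scaleNr => h2.
apply: leq_trans (size_polyMleq _ _) _.
move: (s1 q k) h2; set a := size _; set b := size _ => ha hb; lia.
Qed.

Lemma genpoly_lead p q k l :
  (genpoly p q k l)`_(k + l) = q ^+ k * (- p) ^+ l.
Proof.
have e2 j : ((1 - p *: 'X) ^+ l : {poly R})`_j = 'C(l, j)%:R * (- p) ^+ j.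
  by rewrite -coef_linear_exp scaleNr.
rewrite /genpoly coefM.
have hk : (k < (k + l).+1)%N by rewrite ltnS leq_addr.
rewrite (bigD1 (Ordinal hk)) //= big1 ?addr0; last first.
  move=> i hi; rewrite coef_linear_exp e2.
  have {}hi : (i : nat) != k by apply: contraNneq hi => e; apply/eqP/val_inj.
  case: (ltnP k i) => hki; first by rewrite bin_small ?mul0r.
  by rewrite (@bin_small l) ?mul0r ?mulr0 //; have := ltn_ord i; lia.
by rewrite coef_linear_exp e2 addKn !binn !mul1r.
Qed.

(** Binomial theorem for X = (1 + qX) - (1 - pX), which holds because p + q = 1;
it expresses the orthogonality of the dual polynomials to constants. *)
Lemma genpoly_alternating_sum p q N : p + q = 1 ->
  \sum_(k < N.+1) ((-1) ^+ (N - k) * 'C(N, k)%:R) *: genpoly p q k (N - k)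
  = 'X^N.
Proof.
move=> hpq.
have -> : 'X^N = (- (1 - p *: 'X) + (1 + q *: 'X)) ^+ N :> {poly R}.
  congr (_ ^+ _); rewrite -[LHS]mul1r -[1 in LHS]/(1%:P) -hpq polyCD.
  by rewrite -!mul_polyC; ring.
rewrite exprDn; apply: eq_bigr => k _.
rewrite (exprNn (1 - _)) -[RHS]mulr_natr -[LHS]mul_polyC /genpoly polyCM.
rewrite [((-1) ^+ (N - k))%:P]rmorphXn rmorphN1 (polyC_natr R); ring.
Qed.
End IntegerArguments.

(** * Interpolation at the integers *)

Section Interpolation.
Context {R : realType}.
Implicit Types (p q x : R) (k l m n N : nat).

Lemma binomR_nat k n : binomR (k%:R : R) n = 'C(k, n)%:R.
Proof.
rewrite /binomR; have -> : \prod_(i < n) (k%:R - i%:R : R) = (k ^_ n)%:R.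
  elim: n => [|n ih]; first by rewrite big_ord0 ffactn0.
  rewrite big_ord_recr /= ih ffactnSr natrM.
  case: (leqP n k) => h; first by rewrite natrB.
  by rewrite ffact_small // !mul0r.
by rewrite -bin_ffact natrM mulfK // pnatr_eq0 -lt0n fact_gt0.
Qed.

Lemma krawtchouk_nat p q N n k : (k <= N)%N ->
  krawtchouk p q N n k%:R = (genpoly p q k (N - k))`_n.
Proof.
move=> kN; rewrite /krawtchouk /genpoly coefM; apply: eq_bigr => i _.
rewrite -natrB // !binomR_nat -scaleNr !coef_linear_exp; ring.
Qed.

Lemma size_prod_linear N (P : pred 'I_N) (F : 'I_N -> {poly R}) :
  (forall i, size (F i) <= 2)%N ->
  (size (\prod_(i < N | P i) F i)%R <= #|P|.+1)%N.
Proof.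
move=> sF; apply: leq_trans (size_prod_leq _ _) _.
apply: (@leq_trans ((\sum_(i < N | P i) 2).+1 - #|P|)%N).
  by rewrite leq_sub2r // ltnS leq_sum.
have h (c : nat) : ((c * 2).+1 - c <= c.+1)%N by lia.
by rewrite sum_nat_const; exact: h.
Qed.

Lemma krawtchouk_poly p q N n :
  exists2 P : {poly R}, (size P <= n.+1)%N & forall x, P.[x] = krawtchouk p q N n x.
Proof.
pose A k : {poly R} := \prod_(i < k) ('X - i%:R%:P).
pose B k : {poly R} := \prod_(i < k) ((N%:R - i%:R)%:P - 'X).
have sA k : (size (A k) <= k.+1)%N.
  rewrite -[in k.+1](card_ord k).
  by apply: size_prod_linear => i; rewrite size_XsubC.
have sB k : (size (B k) <= k.+1)%N.
  rewrite -[in k.+1](card_ord k).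
  by apply: size_prod_linear => i; rewrite -opprB size_polyN size_XsubC.
exists (\sum_(k < n.+1) (q ^+ k * (- p) ^+ (n - k) / k`!%:R / (n - k)`!%:R)
          *: (A k * B (n - k)%N)).
  apply: leq_trans (size_sum _ _ _) _; apply/bigmax_leqP => k _.
  apply: leq_trans (size_scale_leq _ _) _.
  apply: leq_trans (size_polyMleq _ _) _.
  move: (sA k) (sB (n - k)%N) (ltn_ord k); set a := size _; set b := size _.
  by lia.
move=> x; rewrite horner_sum; apply: eq_bigr => k _.
have eA i : (A i).[x] = \prod_(r < i) (x - r%:R).
  by rewrite horner_prod; apply: eq_bigr => r _; rewrite hornerXsubC.
have eB i : (B i).[x] = \prod_(r < i) (N%:R - x - r%:R).
  rewrite horner_prod; apply: eq_bigr => r _.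
  by rewrite hornerD hornerN hornerX hornerC addrAC.
by rewrite hornerZ hornerM eA eB /binomR; ring.
Qed.

Definition lagrangeR N k x : R := \prod_(i < N.+1 | i != k :> nat) ((x - i%:R) / (k%:R - i%:R)).

Lemma lagrange_interpolation N (P : {poly R}) x : (size P <= N.+1)%N ->
  P.[x] = \sum_(k < N.+1) P.[k%:R] * lagrangeR N k x.
Proof.
move=> sP.
pose L k : {poly R} :=
  \prod_(i < N.+1 | i != k :> nat) ((k%:R - i%:R)^-1 *: ('X - i%:R%:P)).
have LE k z : (L k).[z] = lagrangeR N k z.
  rewrite horner_prod; apply: eq_bigr => i _.
  by rewrite hornerZ hornerXsubC mulrC.
have sL (k : 'I_N.+1) : (size (L k) <= N.+1)%N.
  have cN : #|[pred i : 'I_N.+1 | i != k :> nat]| = N.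
    by rewrite (eq_card (B := predC1 k)) ?cardC1 ?card_ord // => i; rewrite !inE.
  rewrite -[X in (_ <= X.+1)%N]cN; apply: size_prod_linear => i.
  by rewrite (leq_trans (size_scale_leq _ _)) // size_XsubC.
have LL (k j : 'I_N.+1) : (L k).[j%:R] = (k == j)%:R.
  rewrite LE /lagrangeR; case: eqP => [->|/eqP kj].
    by rewrite big1 // => i ij; rewrite divff // subr_eq0 eqr_nat eq_sym.
  by rewrite (bigD1 j) /= ?subrr ?mul0r // eq_sym.
pose Q := \sum_(k < N.+1) P.[k%:R] *: L k.
suff PQ : P = Q.
  rewrite [in LHS]PQ horner_sum; apply: eq_bigr => k _.
  by rewrite hornerZ LE.
apply/eqP; rewrite -subr_eq0; apply/negPn/negP => nz.
have us : uniq [seq (i%:R : R) | i <- iota 0 N.+1].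
  by rewrite map_inj_uniq ?iota_uniq //; apply: mulrIn; rewrite oner_eq0.
have hr : all (root (P - Q)) [seq (i%:R : R) | i <- iota 0 N.+1].
  apply/allP => z /mapP[i]; rewrite mem_iota add0n /= => iN ->.
  rewrite rootE hornerD hornerN horner_sum (bigD1 (Ordinal iN)) //= hornerZ.
  rewrite (LL (Ordinal iN) (Ordinal iN)) eqxx mulr1 big1 ?addr0 ?subrr //.
  by move=> k ki; rewrite hornerZ (LL k (Ordinal iN)) (negPf ki) mulr0.
have := max_poly_roots nz hr us; rewrite size_map size_iota ltnNge => /negP; apply.
rewrite (leq_trans (size_polyD _ _)) // size_polyN geq_max sP /=.
apply: leq_trans (size_sum _ _ _) _; apply/bigmax_leqP => k _.
by apply: leq_trans (size_scale_leq _ _) _.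
Qed.

(** Splits a product at the omitted index, so that each half is a product of
consecutive integers when F is a difference of nodes. *)
Lemma prod_skip N k (F : nat -> R) : (k <= N)%N ->
  \prod_(i < N.+1 | i != k :> nat) F i
  = (\prod_(i < k) F i) * \prod_(i < N - k) F (k + i.+1)%N.
Proof.
move=> kN; rewrite -(big_mkord (fun i => i != k) F).
rewrite (big_cat_nat (n := k)) ?leqW //= [X in _ * X]big_ltn_cond ?ltnS // eqxx /=.
congr (_ * _).
  rewrite big_nat_cond (eq_bigl (fun i => (0 <= i < k)%N && true)); last first.
    by move=> i /=; case: ltngtP => //=; rewrite ?andbF.
  by rewrite -big_nat_cond big_mkord.
rewrite big_nat_cond (eq_bigl (fun i => (k.+1 <= i < N.+1)%N && true)); last first.
  by move=> i /=; case: ltngtP => //=; rewrite ?andbF.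
rewrite -big_nat_cond -{1}(addn0 k.+1) addnC big_addn big_mkord subSS.
by apply: eq_bigr => i _; congr F; lia.
Qed.

Lemma prod_node_differences N k : (k <= N)%N ->
  \prod_(i < N.+1 | i != k :> nat) (k%:R - i%:R : R)
  = (-1) ^+ (N - k) * (k`!)%:R * ((N - k)`!)%:R.
Proof.
move=> kN; rewrite (prod_skip _ _ (fun i => k%:R - i%:R)) //.
have := binomR_nat k k; rewrite /binomR binn => /(congr1 (fun z => z * k`!%:R)).
rewrite mulfVK ?mul1r ?pnatr_eq0 -?lt0n ?fact_gt0 // => ->.
have -> : \prod_(i < N - k) (k%:R - (k + i.+1)%:R : R) = \prod_(i < N - k) (- (i.+1)%:R).
  by apply: eq_bigr => i _; rewrite natrD opprD addrA subrr add0r.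
rewrite prodrN card_ord -natr_prod.
have -> : (\prod_(i < N - k) i.+1 = (N - k)`!)%N.
  by rewrite fact_prod big_add1 big_mkord.
ring.
Qed.

(** The numerator of a basis polynomial, times the missing factor x - m, is the
full product over the nodes, that is (N+1)! C(x, N+1). *)
Lemma lagrangeR_nearest N m (x : R) : (m <= N)%N ->
  (N.+1%:R) * 'C(N, m)%:R * binomR x N.+1 =
  (-1) ^+ (N - m) * (x - m%:R) * lagrangeR N m x.
Proof.
move=> mN; rewrite /lagrangeR prodf_div prod_node_differences //.
have -> : binomR x N.+1 = (\prod_(i < N.+1) (x - i%:R)) / (N.+1)`!%:R by [].
have e : 'C(N, m)%:R * (m`!%:R * (N - m)`!%:R) = N`!%:R :> R.
  by rewrite -!natrM bin_fact.
rewrite factS natrM -e (bigD1 (Ordinal (mN : (m < N.+1)%N))) //=.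
set T := \prod_(i < N.+1 | _) _.
have f (i : nat) : (i`!%:R : R) != 0 by rewrite pnatr_eq0 -lt0n fact_gt0.
have c : ('C(N, m)%:R : R) != 0 by rewrite pnatr_eq0 -lt0n bin_gt0.
have s : (-1) ^+ (N - m) != 0 :> R by rewrite signr_eq0.
by field; rewrite !f c s addrC natr1 pnatr_eq0.
Qed.

(** The basis polynomial of m is kept as it is, because x may coincide with m;
for the other nodes it is rewritten with a denominator x - k. *)
Lemma krawtchouk_interpolation p q N n m x :
  (n <= N)%N -> (m <= N)%N -> (forall k, (k <= N)%N -> k != m -> x != k%:R) ->
  krawtchouk p q N n x =
  (genpoly p q m (N - m))`_n * lagrangeR N m x +
  N.+1%:R * binomR x N.+1 *
  \sum_(k < N.+1 | k != m :> nat)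
     (-1) ^+ (N - k) * 'C(N, k)%:R * (genpoly p q k (N - k))`_n / (x - k%:R).
Proof.
move=> nN mN hx; have [P sP PE] := krawtchouk_poly p q N n.
rewrite -PE (lagrange_interpolation N) ?(leq_trans sP) ?ltnS //.
rewrite (bigD1 (Ordinal (mN : (m < N.+1)%N))) //= PE krawtchouk_nat //; congr (_ + _).
rewrite mulr_sumr; apply: eq_bigr => k km.
have kN : (k <= N)%N by rewrite -ltnS.
rewrite PE krawtchouk_nat //.
have e := lagrangeR_nearest N k x kN.
have xk : x - k%:R != 0 by rewrite subr_eq0 hx.
have c : ('C(N, k)%:R : R) != 0 by rewrite pnatr_eq0 -lt0n bin_gt0.
have s : (-1) ^+ (N - k) * (-1) ^+ (N - k) = 1 :> R.
  by rewrite -expr2 sqrr_sign.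
have -> : lagrangeR N k x = (-1) ^+ (N - k) * (N.+1%:R * 'C(N, k)%:R * binomR x N.+1) / (x - k%:R).
  by rewrite e !mulrA s mul1r mulrAC divff // mul1r.
ring.
Qed.

(** Reflecting the factors N - x - i of the second binomial makes every summand a
multiple of the full product x (x - 1) .. (x - N), and the coefficients add up
to (p + q)^(N+1). *)
Lemma krawtchouk_above_degree p q N x : p + q = 1 ->
  krawtchouk p q N N.+1 x = binomR x N.+1.
Proof.
move=> pq1; rewrite /krawtchouk.
have e (k : 'I_N.+2) : binomR x k * binomR (N%:R - x) (N.+1 - k)%N =
  (-1) ^+ (N.+1 - k) * 'C(N.+1, k)%:R * binomR x N.+1.
  have kN : (k <= N.+1)%N by rewrite -ltnS.
  rewrite /binomR.
  have -> : \prod_(i < N.+1) (x - i%:R) =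
    (\prod_(i < k) (x - i%:R)) *
    ((-1) ^+ (N.+1 - k) * \prod_(i < N.+1 - k) (N%:R - x - i%:R)).
    rewrite -(big_mkord xpredT (fun i => x - i%:R)).
    rewrite (big_cat_nat (n := k)) //= big_mkord; congr (_ * _).
    rewrite big_nat_rev -{1}(add0n k) big_addn big_mkord.
    rewrite -[in (-1) ^+ _](card_ord (N.+1 - k)) -prodrN; apply: eq_bigr => i _.
    have iN := ltn_ord i.
    have -> : (k + N.+1 - (i + k).+1 = N - i)%N by lia.
    by rewrite natrB; [ring | lia].
  have <- : 'C(N.+1, k)%:R * (k`!%:R * (N.+1 - k)`!%:R) = (N.+1)`!%:R :> R.
    by rewrite -!natrM bin_fact.
  have f (i : nat) : (i`!%:R : R) != 0 by rewrite pnatr_eq0 -lt0n fact_gt0.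
  have c : ('C(N.+1, k)%:R : R) != 0 by rewrite pnatr_eq0 -lt0n bin_gt0.
  have s : (-1) ^+ (N.+1 - k) * (-1) ^+ (N.+1 - k) = 1 :> R.
    by rewrite -expr2 sqrr_sign.
  set A := \prod_(_ < _) _; set B := \prod_(_ < _) _.
  transitivity (((-1) ^+ (N.+1 - k) * (-1) ^+ (N.+1 - k)) * (A * B) / (k`!%:R * (N.+1 - k)`!%:R)).
    by rewrite s; field; rewrite !f.
  by field; rewrite !f c.
under eq_bigr do rewrite e.
transitivity ((p + q) ^+ N.+1 * binomR x N.+1); last by rewrite pq1 expr1n mul1r.
rewrite exprDn mulr_suml; apply: eq_bigr => k _.
rewrite -[(_ * _) *+ _]mulr_natr (exprNn p).
have s : (-1) ^+ (N.+1 - k) * (-1) ^+ (N.+1 - k) = 1 :> R by rewrite -expr2 sqrr_sign.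
transitivity (((-1) ^+ (N.+1 - k) * (-1) ^+ (N.+1 - k)) * (p ^+ (N.+1 - k) * q ^+ k * 'C(N.+1, k)%:R * binomR x N.+1)); first by ring.
by rewrite s mul1r.
Qed.
End Interpolation.

(** * The binomial law and the dual polynomials *)

Section BinomialLaw.
Context {R : realType}.
Implicit Types (p q x : R) (k l m n N i : nat).

Definition bweight p q N k : R := 'C(N, k)%:R * q ^+ k * p ^+ (N - k).

(** Dual Krawtchouk polynomial of degree i - 1 in k, scaled so that the one of
degree 0 is the constant 1.  The index is shifted by one so that the recurrence
starts from the value 0 at i = 0. *)
Definition dualK p q N i k : R :=
  (genpoly p q k (N - k))`_(N.+1 - i) / (q ^+ k * (- p) ^+ (N - k)).

Lemma dualK0 p q N k : (k <= N)%N -> dualK p q N 0 k = 0.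
Proof.
move=> kN; rewrite /dualK subn0 nth_default ?mul0r //.
by rewrite (leq_trans (size_genpoly_le _ _ _ _)) // subnKC.
Qed.

Lemma dualK1 p q N k : p != 0 -> q != 0 -> (k <= N)%N -> dualK p q N 1 k = 1.
Proof.
move=> p0 q0 kN; rewrite /dualK subn1 /= -[in X in X / _](subnKC kN) addKn.
by rewrite genpoly_lead divff // mulf_neq0 ?expf_neq0 // oppr_eq0.
Qed.

Lemma dualK_rec p q N i k : p != 0 -> q != 0 -> p + q = 1 ->
  (i.+1 <= N)%N -> (k <= N)%N ->
  p * q * i.+1%:R * dualK p q N i.+2 k =
  (k%:R - N%:R * q - (p - q) * i%:R) * dualK p q N i.+1 k
  - (N%:R - i%:R + 1) * dualK p q N i k.
Proof.
move=> p0 q0 pq1 iN kN; rewrite /dualK.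
have := genpoly_coef_rec p q k (N - k) (N - i.+1).
rewrite subnKC //.
have -> : (N.+1 - i = (N - i.+1).+2)%N by lia.
have -> : (N.+1 - i.+1 = (N - i.+1).+1)%N by lia.
have -> : (N.+1 - i.+2 = N - i.+1)%N by lia.
have -> : (N - i.+1).+2%:R = N%:R - i%:R + 1 :> R.
  have -> : (N - i.+1).+2 = (N - i).+1 by lia.
  by rewrite -natr1 natrB // ltnW.
have -> : (N - i.+1).+1%:R = N%:R - i%:R :> R.
  have -> : (N - i.+1).+1 = (N - i)%N by lia.
  by rewrite natrB // ltnW.
rewrite !natrB //.
set u := (genpoly _ _ _ _)`_(_.+2); set v := (genpoly _ _ _ _)`_(_.+1).
set w := (genpoly _ _ _ _)`_(_); move: u v w => u v w.
have -> : q = 1 - p by rewrite -pq1 addrAC subrr add0r.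
set z := (_ ^+ _ * _ ^+ _); move=> h.
have {}h : (N%:R - i%:R + 1) * u =
  (k%:R * (1 - p) - (N%:R - k%:R) * p) * v
   - N%:R * p * (1 - p) * w - (1 - p - p) * (N%:R - i%:R) * v
   + p * (1 - p) * (N%:R - i.+1%:R) * w.
  by rewrite -h; ring.
rewrite -[RHS](_ : ((k%:R - N%:R * (1 - p) - (p - (1 - p)) * i%:R) * v
   - (N%:R - i%:R + 1) * u) / z = _); last by ring.
by rewrite h; ring.
Qed.

Lemma bweight_ge0 p q N k : 0 <= p -> 0 <= q -> 0 <= bweight p q N k.
Proof. by move=> p0 q0; rewrite !mulr_ge0 ?exprn_ge0. Qed.

Lemma bweight_dualK p q N i k : p != 0 -> q != 0 ->
  bweight p q N k * dualK p q N i k =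
  (-1) ^+ (N - k) * 'C(N, k)%:R * (genpoly p q k (N - k))`_(N.+1 - i).
Proof.
move=> p0 q0; rewrite /bweight /dualK (exprNn p).
set s := (-1) ^+ _; have s2 : s * s = 1 by rewrite -expr2 sqrr_sign.
have s0 : s != 0 by rewrite signr_eq0.
have hq : q ^+ k != 0 by rewrite expf_neq0.
have hp : p ^+ (N - k) != 0 by rewrite expf_neq0.
set C := 'C(_, _)%:R; set g := _`_ _.
have -> : s * C * g = (s * s) * (C * g) / s by field.
by rewrite s2; field; rewrite hq hp s0.
Qed.

Lemma dualK_mean p q N i : p != 0 -> q != 0 -> p + q = 1 -> (i <= N)%N ->
  \sum_(k < N.+1) bweight p q N k * dualK p q N i.+1 k = (i == 0)%:R.
Proof.
move=> p0 q0 pq1 iN.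
under eq_bigr do rewrite bweight_dualK // -coefZ.
rewrite -coef_sum genpoly_alternating_sum // coefXn.
by congr ((nat_of_bool _)%:R); apply/eqP/eqP; lia.
Qed.

(** Interpolation, with the weights at the nodes written as binomial
probabilities times dual polynomials. *)
Lemma krawtchouk_decomposition p q N i m x : p != 0 -> q != 0 ->
  (i <= N)%N -> (m <= N)%N -> (forall k, (k <= N)%N -> k != m -> x != k%:R) ->
  krawtchouk p q N (N - i) x =
  q ^+ m * (- p) ^+ (N - m) * dualK p q N i.+1 m * lagrangeR N m x +
  binomR x N.+1 * (N.+1%:R *
  \sum_(k < N.+1 | k != m :> nat)
     bweight p q N k * dualK p q N i.+1 k / (x - k%:R)).
Proof.
move=> p0 q0 iN mN hx; rewrite (krawtchouk_interpolation _ _ _ _ m) ?leq_subr //.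
congr (_ + _).
  rewrite /dualK subSS [_ ^+ _ * _ * _]mulrC divfK //.
  by rewrite mulf_neq0 ?expf_neq0 // oppr_eq0.
rewrite [RHS]mulrCA [RHS]mulrA; congr (_ * _); apply: eq_bigr => k _.
by rewrite bweight_dualK // subSS.
Qed.

Lemma expR_quadratic x : x <= 2^-1 -> expR x <= 1 + x + 2 * x ^+ 2.
Proof.
move=> hx; have h := expR_ge1Dx (- x).
have x1 : 0 < 1 - x by lra.
have : expR x <= (1 - x)^-1.
  by rewrite -[expR x]invrK -expRN lef_pV2 // posrE ?expR_gt0 //.
move/le_trans; apply; rewrite -div1r ler_pdivrMr //.
have : 0 <= x ^+ 2 * (1 - 2 * x) by rewrite mulr_ge0 ?sqr_ge0 //; lra.
by rewrite !expr2; lra.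
Qed.

(** Exponential moments of a centred binomial variable are at most Gaussian: the
variable is a sum of N independent centred ones, for each of which the second
order bound on the exponential suffices. *)
Lemma bweight_mgf p q N (la : R) : 0 < p -> 0 < q -> p + q = 1 -> `|la| <= 2^-1 ->
  \sum_(k < N.+1) bweight p q N k * expR (la * (k%:R - N%:R * q))
  <= expR (2 * N%:R * la ^+ 2).
Proof.
move=> p0 q0 pq1 hla.
have -> : \sum_(k < N.+1) bweight p q N k * expR (la * (k%:R - N%:R * q)) =
   (p * expR (la * - q) + q * expR (la * p)) ^+ N.
  rewrite exprDn; apply: eq_bigr => k _.
  have kN : (k <= N)%N by rewrite -ltnS.
  have -> : la * (k%:R - N%:R * q) = (N - k)%:R * (la * - q) + k%:R * (la * p).
    rewrite natrB //; have -> : p = 1 - q by rewrite -pq1 addrK.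
    ring.
  rewrite expRD !expRM_natl !exprMn -[RHS]mulr_natr /bweight; ring.
have hp1 : p < 1 by lra.
have hq1 : q < 1 by lra.
have b1 (z : R) : `|z| <= 1 -> la * z <= 2^-1.
  move=> hz; apply: le_trans (ler_norm _) _; rewrite normrM.
  by rewrite -[2^-1]mulr1 ler_pM.
have e1 : expR (la * - q) <= 1 + la * - q + 2 * (la * - q) ^+ 2.
  by apply/expR_quadratic/b1; rewrite normrN ger0_norm; lra.
have e2 : expR (la * p) <= 1 + la * p + 2 * (la * p) ^+ 2.
  by apply/expR_quadratic/b1; rewrite ger0_norm; lra.
have h : p * expR (la * - q) + q * expR (la * p) <= expR (2 * la ^+ 2).
  apply: le_trans (expR_ge1Dx _).
  apply: (@le_trans _ _ (p * (1 + la * - q + 2 * (la * - q) ^+ 2) +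
     q * (1 + la * p + 2 * (la * p) ^+ 2))).
    by rewrite lerD // ler_pM2l.
  have -> : p * (1 + la * - q + 2 * (la * - q) ^+ 2) +
     q * (1 + la * p + 2 * (la * p) ^+ 2) =
     (p + q) + 2 * (p * q * (p + q)) * la ^+ 2 by ring.
  rewrite pq1 mulr1 lerD2l ler_wpM2r ?sqr_ge0 //.
  have : p * q <= 1 by rewrite mulr_ile1 //; lra.
  lra.
have -> : 2 * N%:R * la ^+ 2 = N%:R * (2 * la ^+ 2) by ring.
by rewrite expRM_natl lerXn2r ?nnegrE ?expR_ge0 // addr_ge0 // mulr_ge0 ?expR_ge0 // ltW.
Qed.

(** Central moments of order d are of size N^(d/2): with s the square root of N,
(1 + z/s)^d <= exp(dz/s), to which the exponential bound applies with
parameter d/s. *)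
Lemma bweight_moment p q N d (s : R) : 0 < p -> 0 < q -> p + q = 1 ->
  0 < s -> s ^+ 2 = N%:R -> 2 * d%:R <= s ->
  \sum_(k < N.+1) bweight p q N k * (s + `|k%:R - N%:R * q|) ^+ d
  <= 2 * expR (2 * d%:R ^+ 2) * s ^+ d.
Proof.
move=> p0 q0 pq1 s0 sN ds.
pose la : R := d%:R / s.
have hla : `|la| <= 2^-1.
  rewrite /la ger0_norm ?divr_ge0 ?(ltW s0) // ler_pdivrMr //; lra.
have key (u : R) : (s + `|u|) ^+ d <= s ^+ d * (expR (la * u) + expR ((- la) * u)).
  have -> : s + `|u| = s * (1 + `|u| / s) by field; rewrite gt_eqF.
  rewrite exprMn ler_pM2l ?exprn_gt0 //.
  apply: (@le_trans _ _ (expR (la * `|u|))).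
    have -> : la * `|u| = d%:R * (`|u| / s) by rewrite /la; ring.
    rewrite expRM_natl lerXn2r ?nnegrE ?expR_ge0 ?expR_ge1Dx //.
    by rewrite addr_ge0 // divr_ge0 // ltW.
  by case: (ger0P u) => _; rewrite ?mulrN ?mulNr ?lerDl ?lerDr expR_ge0.
have m1 := bweight_mgf p q N la p0 q0 pq1 hla.
have m2 : \sum_(k < N.+1) bweight p q N k * expR ((- la) * (k%:R - N%:R * q))
  <= expR (2 * N%:R * la ^+ 2).
  by rewrite -[la ^+ 2]sqrrN; apply: bweight_mgf => //; rewrite normrN.
have el : 2 * N%:R * la ^+ 2 = 2 * d%:R ^+ 2.
  by rewrite /la -sN; field; rewrite gt_eqF.
rewrite el in m1 m2.
apply: (@le_trans _ _ (s ^+ d * (\sum_(k < N.+1) bweight p q N k * expR (la * (k%:R - N%:R * q)) +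
  \sum_(k < N.+1) bweight p q N k * expR ((- la) * (k%:R - N%:R * q))))).
  rewrite -big_split /= mulr_sumr; apply: ler_sum => k _.
  rewrite -mulrDr mulrCA ler_wpM2l //.
  by apply: bweight_ge0; apply: ltW.
rewrite [leRHS]mulrC ler_pM2l ?exprn_gt0 //; lra.
Qed.

End BinomialLaw.

(** * Uniform order estimates *)

Section Orders.
Context {R : realType} (D : set R).
Implicit Types (d e : nat) (f g : nat * R -> R).

(** Large N, with a second variable that ranges over D without restriction:
properties near this filter are those that hold for N large, uniformly in D. *)
Definition uniformly : set_system (nat * R) :=
  [set A | \forall N \near \oo, forall y, D y -> A (N, y)].

Global Instance uniformly_filter : Filter uniformly.
Proof.
split; rewrite /uniformly /=.
- by exists 0%N.
- move=> P Q hP hQ.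
  change (\forall N \near \oo, forall y, D y -> (P `&` Q) (N, y)).
  change (\forall N \near \oo, forall y, D y -> P (N, y)) in hP.
  change (\forall N \near \oo, forall y, D y -> Q (N, y)) in hQ.
  by apply: filterS2 hP hQ => N hp hq y Dy; split; [apply: hp | apply: hq].
- move=> P Q PQ hP.
  change (\forall N \near \oo, forall y, D y -> Q (N, y)).
  change (\forall N \near \oo, forall y, D y -> P (N, y)) in hP.
  by apply: filterS hP => N hp y Dy; apply/PQ/hp.
Qed.

Lemma nearE_uniformly (A : set (nat * R)) :
  (\forall t \near uniformly, A t) =
  (\forall N \near \oo, forall y, D y -> A (N, y)).
Proof. by []. Qed.

Lemma uniformly_fst (P : set nat) :
  (\forall N \near \oo, P N) -> \forall t \near uniformly, P t.1.
Proof. by rewrite nearE_uniformly; apply: filterS => N PN y _. Qed.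

Lemma uniformly_snd (P : set R) :
  (forall y, D y -> P y) -> \forall t \near uniformly, P t.2.
Proof. by move=> h; rewrite nearE_uniformly; apply: nearW => N y /h. Qed.

Definition sqrtN (t : nat * R) : R := Num.sqrt t.1%:R.

Lemma sqr_sqrtN t : sqrtN t ^+ 2 = t.1%:R.
Proof. by rewrite sqr_sqrtr. Qed.

Lemma sqrtN_large (r : R) : \forall t \near uniformly, r <= sqrtN t.
Proof.
have h : \forall N \near \oo, (r ^+ 2 <= N%:R :> R) by exact: nbhs_infty_ger.
apply: filterS (uniformly_fst _ h) => t /= ht.
apply: (le_trans (ler_norm r)).
by rewrite -(@ler_pXn2r _ 2) ?nnegrE ?sqrtr_ge0 // sqr_sqrtN real_normK ?num_real.
Qed.

(** Growth at most (square root of N)^d.  Natural exponents of the square root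
are enough: decay is always expressed by multiplying by a power of N. *)
Definition order_le d f := exists K : R,
  \forall t \near uniformly, `|f t| <= K * sqrtN t ^+ d.

Lemma order_leP d f : order_le d f -> exists2 K : R, 0 <= K &
  \forall t \near uniformly, `|f t| <= K * sqrtN t ^+ d.
Proof.
move=> [K hK]; exists `|K| => //; apply: filterS hK => t /le_trans; apply.
by rewrite ler_wpM2r ?exprn_ge0 ?sqrtr_ge0 ?ler_norm.
Qed.

Lemma order_le_dom d f g : (\forall t \near uniformly, `|f t| <= `|g t|) ->
  order_le d g -> order_le d f.
Proof.
by move=> h [K hK]; exists K; apply: filterS2 h hK => t; apply: le_trans.
Qed.

Lemma order_le_eq d f g : (\forall t \near uniformly, f t = g t) ->
  order_le d g -> order_le d f.
Proof. by move=> h; apply: order_le_dom; apply: filterS h => t ->. Qed.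

Lemma order_le_bounded f (K : R) :
  (\forall t \near uniformly, `|f t| <= K) -> order_le 0 f.
Proof. by move=> h; exists K; apply: filterS h => t; rewrite expr0 mulr1. Qed.

Lemma order_le_cst (K : R) : order_le 0 (fun=> K).
Proof. by apply: (order_le_bounded _ `|K|); apply: nearW. Qed.

Lemma order_leW d e f : (d <= e)%N -> order_le d f -> order_le e f.
Proof.
move=> de /order_leP[K K0 hK]; exists K.
apply: filterS2 hK (sqrtN_large 1) => t h s1; apply: le_trans h _.
by rewrite ler_wpM2l // ler_weXn2l.
Qed.

Lemma order_leN d f : order_le d f -> order_le d (fun t => - f t).
Proof. by apply: order_le_dom; apply: nearW => t; rewrite normrN. Qed.

Lemma order_leD d f g : order_le d f -> order_le d g ->
  order_le d (fun t => f t + g t).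
Proof.
move=> [K hK] [L hL]; exists (K + L); apply: filterS2 hK hL => t hf hg.
by rewrite (le_trans (ler_normD _ _)) // mulrDl lerD.
Qed.

Lemma order_leB d f g : order_le d f -> order_le d g ->
  order_le d (fun t => f t - g t).
Proof. by move=> hf hg; apply: order_leD => //; apply: order_leN. Qed.

Lemma order_leM d e f g : order_le d f -> order_le e g ->
  order_le (d + e) (fun t => f t * g t).
Proof.
move=> [K hK] [L hL]; exists (K * L).
apply: filterS2 hK hL => t hf hg.
by rewrite normrM exprD mulrACA ler_pM.
Qed.

Lemma order_leX f i : order_le 0 f -> order_le 0 (fun t => f t ^+ i).
Proof.
move=> Of; elim: i => [|i ih]; first exact: order_le_cst.
apply: order_le_eq (order_leM 0 0 _ _ Of ih).
by apply: nearW => t; rewrite exprS.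
Qed.

Lemma order_le_sqrtN d : order_le d (fun t => sqrtN t ^+ d).
Proof.
by exists 1; apply: nearW => t; rewrite mul1r ger0_norm ?exprn_ge0 ?sqrtr_ge0.
Qed.

Lemma order_le_N : order_le 2 (fun t => t.1%:R).
Proof. by apply: order_le_eq (order_le_sqrtN 2); apply: nearW => t; rewrite sqr_sqrtN. Qed.

Lemma order_le_cancel d e f :
  order_le (e + d) (fun t => sqrtN t ^+ e * f t) -> order_le d f.
Proof.
move=> [K hK]; exists K; apply: filterS2 hK (sqrtN_large 1) => t h s1.
have s0 : 0 < sqrtN t ^+ e by rewrite exprn_gt0 // (lt_le_trans ltr01).
by move: h; rewrite normrM (gtr0_norm s0) exprD mulrCA ler_pM2l.
Qed.

Lemma order_le_cancelN d f :
  order_le d.+2 (fun t => t.1%:R * f t) -> order_le d f.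
Proof.
move=> h; apply: (order_le_cancel d 2); apply: order_le_eq h.
by apply: nearW => t; rewrite sqr_sqrtN.
Qed.

Lemma order_le_small f (e : R) : 0 < e -> order_le 0 (fun t => sqrtN t * f t) ->
  \forall t \near uniformly, `|f t| <= e.
Proof.
move=> e0 [K hK]; apply: filterS2 hK (sqrtN_large (Num.max 1 (K / e))) => t.
rewrite expr0 mulr1 ge_max normrM => h /andP[s1 s2].
have s0 : 0 < sqrtN t by rewrite (lt_le_trans ltr01).
rewrite (gtr0_norm s0) in h; rewrite -(ler_pM2l s0); apply: le_trans h _.
by rewrite -ler_pdivrMr.
Qed.

Lemma order_le_smallN f (e : R) : 0 < e -> order_le 0 (fun t => t.1%:R * f t) ->
  \forall t \near uniformly, `|f t| <= e.
Proof.
move=> e0 h; apply: order_le_small => //; apply: (order_le_cancel 0 1).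
apply: (order_leW 0) => //; apply: order_le_eq h; apply: nearW => t.
by rewrite mulrA -expr2 sqr_sqrtN.
Qed.
End Orders.

(** * Bootstrapping a three-term recurrence *)

Section Bootstrap.
Context {R : realType} (D : set R).
Local Notation O := (order_le D).

(** If V_i has order i + 1, then dividing the recurrence by N c bounds V_(i+1) by
V_i up to terms with V_(i+1) and V_(i+2) that carry a factor 1/N.  Hence a bound
of order i + 1 - s for all i implies one of order i - s, and after i + 1 rounds
V_i is bounded.  The recurrence then reads V_(i+1) = V_i / c + O(1/N). *)
Lemma bootstrap (p q : R) (c : nat * R -> R) (V eps : nat -> nat * R -> R) :
  (\forall t \near uniformly D, c t != 0) -> O 0 (fun t => (c t)^-1) ->
  (forall t, V 0%N t = 1) ->
  (forall i, O i.+1 (V i)) -> (forall i, O 0 (eps i)) ->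
  (forall i, \forall t \near uniformly D,
     t.1%:R * c t * V i.+1 t = (t.1%:R - i%:R + 1) * V i t
       + (p - q) * i%:R * V i.+1 t + p * q * i.+1%:R * V i.+2 t + eps i t) ->
  forall i, O 0 (fun t => t.1%:R * (V i t - (c t)^-1 ^+ i)).
Proof.
move=> c0 Oc V0 crude Oeps rec.
have OV0 : O 0 (V 0%N).
  by apply: order_le_eq (order_le_cst D 1); apply: nearW => t; rewrite V0.
(* The truncated subtraction records that orders never drop below 0. *)
have OVs s i : O (i.+1 - s) (V i).
  elim: s i => [|s ihs] i; first by rewrite subn0.
  elim: i => [|i ihi]; first by apply: order_leW OV0.
  rewrite subSS; apply: order_le_cancelN.
  pose g t := (c t)^-1 * ((t.1%:R - i%:R + 1) * V i t
       + (p - q) * i%:R * V i.+1 t + p * q * i.+1%:R * V i.+2 t + eps i t).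
  apply: (order_le_eq _ _ _ g).
    apply: filterS2 c0 (rec i) => t ct e; rewrite /g -e.
    by field.
  rewrite -[(_ - s).+2]add0n; apply: order_leM => //.
  have c2 (K : R) (f : nat * R -> R) d : (d <= (i.+1 - s).+2)%N -> O d f ->
      O (i.+1 - s).+2 (fun t => K * f t).
    move=> dd Of; apply: (order_leW _ (0 + d)) => //.
    exact: order_leM (order_le_cst _ _) Of.
  apply: order_leD; [apply: order_leD; [apply: order_leD|]|].
  - apply: (order_leW _ (2 + (i.+1 - s.+1))); first lia.
    apply: order_leM => //.
    apply: order_leD; last by apply: (order_leW _ 0 2) => //; exact: order_le_cst.
    apply: order_leB; first exact: order_le_N.
    by apply: (order_leW _ 0 2) => //; exact: order_le_cst.
  - by apply: c2 (ihs i.+1); lia.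
  - by apply: c2 (ihs i.+2); lia.
  - by apply: order_leW (Oeps i).
have OV i : O 0 (V i) by have := OVs i.+1 i; rewrite subnn.
elim=> [|i ih].
  apply: order_le_eq (order_le_cst D 0); apply: nearW => t.
  by rewrite V0 subrr mulr0.
pose g t := (c t)^-1 * (((1 - i%:R) * V i t
       + (p - q) * i%:R * V i.+1 t + p * q * i.+1%:R * V i.+2 t + eps i t)
       + t.1%:R * (V i t - (c t)^-1 ^+ i)).
apply: (order_le_eq _ _ _ g).
  apply: filterS2 c0 (rec i) => t ct e; rewrite /g.
  have -> : V i.+1 t = (c t)^-1 * (c t * V i.+1 t) by field.
  rewrite exprS -mulrBr mulrCA; congr (_ * _).
  have -> : t.1%:R * (c t * V i.+1 t - (c t)^-1 ^+ i) =
    t.1%:R * c t * V i.+1 t - t.1%:R * (c t)^-1 ^+ i by ring.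
  rewrite e.
  have -> : (c t)^-1 * (c t * V i.+1 t) = V i.+1 t by field.
  ring.
have c1 (K : R) f : O 0 f -> O 0 (fun t => K * f t).
  by move=> Of; exact: order_leM (order_le_cst _ _) Of.
apply: (order_leM _ 0 0) => //; apply: order_leD => //.
by do ![apply: order_leD]; rewrite //; apply: c1.
Qed.
End Bootstrap.

Section Moments.
Context {R : realType}.
Variables (p q : R).
Hypotheses (p0 : 0 < p) (q0 : 0 < q) (pq1 : p + q = 1).

Let pN0 : p != 0. Proof. by rewrite gt_eqF. Qed.
Let qN0 : q != 0. Proof. by rewrite gt_eqF. Qed.

Let pq_norm : `|p - q| <= 1. Proof. by rewrite ler_norml; move: p0 q0 pq1 => h1 h2 h3; apply/andP; split; lra. Qed.

(** Each step of the recurrence multiplies by k - Nq or, over two steps, by N, both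
controlled by z.  The extra factor z on the left gives the exponent i - 1 without
spoiling the case i = 0. *)
Lemma dualK_bound i : exists2 C : R, 0 <= C &
  forall N k (s z : R), (k <= N)%N -> (i <= N.+1)%N -> 1 <= s -> s ^+ 2 = N%:R ->
    z = s + `|k%:R - N%:R * q| -> `|dualK p q N i k| * z <= C * z ^+ i.
Proof.
elim/ltn_ind: i => -[|[|i]] ih.
- exists 0 => // N k s z kN _ s1 sN _; rewrite dualK0 // normr0 !mul0r //.
- exists 1 => // N k s z kN _ s1 sN _.
  by rewrite dualK1 // normr1 !mul1r.
have [C1 C10 h1] := ih i.+1 (ltnSn _).
have [C0 C00 h0] := ih i (ltnW (ltnSn _)).
have K0 : 0 < p * q * i.+1%:R by rewrite !mulr_gt0.
exists ((p * q * i.+1%:R)^-1 * ((1 + i%:R) * C1 + 2 * C0)).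
  by rewrite mulr_ge0 ?invr_ge0 ?(ltW K0) // addr_ge0 // mulr_ge0 // addr_ge0.
move=> N k s z kN iN s1 sN zE.
have z1 : 1 <= z by rewrite zE (le_trans s1) // lerDl.
have {}h1 := h1 N k s z kN (ltnW iN) s1 sN zE.
have {}h0 := h0 N k s z kN (ltnW (ltnW iN)) s1 sN zE.
have zi : 0 <= z ^+ i by rewrite exprn_ge0 // (le_trans ler01).
have z0 : 0 <= z by rewrite (le_trans ler01).
have e := dualK_rec p q N i k pN0 qN0 pq1 iN kN.
rewrite -(ler_pM2l K0) [leRHS]mulrA mulVKf ?gt_eqF // mulrA.
have -> : p * q * i.+1%:R * `|dualK p q N i.+2 k| * z =
   `|p * q * i.+1%:R * dualK p q N i.+2 k| * z.
  by rewrite [in RHS]normrM (gtr0_norm K0).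
rewrite e.
have u1 : `|k%:R - N%:R * q - (p - q) * i%:R| <= (1 + i%:R) * z.
  apply: le_trans (ler_normB _ _) _; rewrite [leRHS]mulrDl mul1r lerD //.
    by rewrite zE lerDr (le_trans ler01).
  by rewrite normrM normr_nat mulrC ler_wpM2l // (le_trans _ z1) // pq_norm.
have u2 : `|N%:R - i%:R + 1| <= 2 * z ^+ 2.
  have iN' : i%:R <= N%:R :> R by rewrite ler_nat ltnW.
  have i0 : 0 <= i%:R :> R by [].
  have zN : N%:R <= z ^+ 2.
    by rewrite -sN ler_pXn2r ?nnegrE ?(le_trans ler01 s1) // zE lerDl.
  have zz : 1 <= z ^+ 2 by rewrite exprn_ege1.
  move: (z ^+ 2) zN zz => w zN zz; clear -iN' i0 zN zz.
  by rewrite ger0_norm; lra.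
have gen (a b v w : R) : `|a * v - b * w| * z <= `|a| * (`|v| * z) + `|b| * (`|w| * z).
  by rewrite !mulrA -!normrM -mulrDl ler_wpM2r // ler_normB.
apply: (@le_trans _ _ (`|k%:R - N%:R * q - (p - q) * i%:R| * (`|dualK p q N i.+1 k| * z)
   + `|N%:R - i%:R + 1| * (`|dualK p q N i k| * z))).
  exact: gen.
apply: (@le_trans _ _ ((1 + i%:R) * z * (C1 * z ^+ i.+1) + 2 * z ^+ 2 * (C0 * z ^+ i))).
  by apply: lerD; apply: ler_pM; rewrite // mulr_ge0.
by rewrite le_eqVlt; apply/orP; left; apply/eqP; rewrite !exprS; ring.
Qed.
End Moments.

(** * The nearest node and the remaining nodes *)

Section NearestNode.
Context {R : realType}.
Implicit Types t : nat * R.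

Definition node t : nat := Num.truncn (t.2 * t.1%:R + 2^-1).
Definition offset t : R := t.2 * t.1%:R - (node t)%:R.

Lemma node_itv t : 0 <= t.2 ->
  (node t)%:R <= t.2 * t.1%:R + 2^-1 < (node t).+1%:R.
Proof. by move=> y0; apply: truncn_itv; rewrite addr_ge0 ?mulr_ge0. Qed.

Lemma node_le t : 0 <= t.2 <= 1 -> (node t <= t.1)%N.
Proof.
move=> /andP[y0 y1]; have /andP[h _] := node_itv t y0.
rewrite -ltnS -(ltr_nat R); apply: le_lt_trans h _.
rewrite -(natr1 t.1); have : t.2 * t.1%:R <= t.1%:R by rewrite ler_piMl.
lra.
Qed.

Lemma offset_le t : 0 <= t.2 -> `|offset t| <= 2^-1.
Proof.
move=> /node_itv; rewrite -(natr1 (node t)) => /andP[h1 h2].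
by rewrite /offset ler_norml; apply/andP; split; lra.
Qed.

Lemma node_sep t k : 0 <= t.2 -> k != node t -> 2^-1 <= `|t.2 * t.1%:R - k%:R|.
Proof.
move=> /node_itv /andP[h1 h2]; rewrite neq_ltn => /orP[kn|kn].
  have : k.+1%:R <= (node t)%:R :> R by rewrite ler_nat.
  rewrite -(natr1 k) => h; apply: le_trans (ler_norm _); lra.
have : (node t).+1%:R <= k%:R :> R by rewrite ler_nat.
by move=> h; rewrite distrC; apply: le_trans (ler_norm _); lra.
Qed.

Lemma node_uniq t k : 0 <= t.2 -> k != node t -> t.2 * t.1%:R != k%:R.
Proof.
move=> y0 /(node_sep _ _ y0) h; rewrite -subr_eq0 -normr_gt0.
by apply: lt_le_trans h; rewrite invr_gt0.
Qed.
End NearestNode.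

Section Estimates.
Context {R : realType}.
Variables (p q : R) (D : set R) (delta : R).
Hypotheses (p0 : 0 < p) (q0 : 0 < q) (pq1 : p + q = 1) (delta0 : 0 < delta).
Hypothesis D01 : forall y, D y -> 0 <= y <= 1.
Hypothesis Dq : forall y, D y -> delta <= `|y - q|.
Local Notation O := (order_le D).

Let pN0 : p != 0. Proof. by rewrite gt_eqF. Qed.
Let qN0 : q != 0. Proof. by rewrite gt_eqF. Qed.

Let near01 : \forall t \near uniformly D, 0 <= t.2 <= 1.
Proof. exact: uniformly_snd D01. Qed.

Let nearq : \forall t \near uniformly D, delta <= `|t.2 - q|.
Proof. exact: uniformly_snd Dq. Qed.

Let near_ge j : \forall t \near uniformly D, (j <= t.1)%N.
Proof. exact: (uniformly_fst D _ (nbhs_infty_ge j)). Qed.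

Definition spread t k : R := sqrtN t + `|k%:R - t.1%:R * q|.

Lemma order_moment d :
  O d (fun t => \sum_(k < t.1.+1) bweight p q t.1 k * spread t k ^+ d).
Proof.
exists (2 * expR (2 * d%:R ^+ 2)).
apply: filterS2 (sqrtN_large D (2 * d%:R)) (sqrtN_large D 1) => t hd h1.
have s0 : 0 < sqrtN t by rewrite (lt_le_trans ltr01).
rewrite ger0_norm; last first.
  apply: sumr_ge0 => k _; rewrite mulr_ge0 // ?bweight_ge0 ?(ltW p0) ?(ltW q0) //.
  by rewrite exprn_ge0 // /spread addr_ge0 // ltW.
exact: bweight_moment p0 q0 pq1 s0 (sqr_sqrtN t) hd.
Qed.

(** The part of the interpolation formula that comes from the nodes other than
the nearest one. *)
Definition restsum i t : R :=
  \sum_(k < t.1.+1 | k != node t :> nat)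
    bweight p q t.1 k * dualK p q t.1 i k / (t.2 * t.1%:R - k%:R).

(** The denominators are at least 1/2, and the dual polynomial of degree i is
bounded by the i-th power of the spread, whose mean is controlled by the moments. *)
Lemma order_restsum i : O i (restsum i.+1).
Proof.
have [C C0 hC] := dualK_bound p q p0 q0 pq1 i.+1.
pose M t := \sum_(k < t.1.+1) bweight p q t.1 k * spread t k ^+ i.
apply: (@order_le_dom _ _ _ _ (fun t => (2 * C) * M t)); last first.
  by apply: (order_leM _ 0 i); [exact: order_le_cst | exact: order_moment].
apply: filterS3 near01 (near_ge i) (sqrtN_large D 1) => t /andP[y0 y1] iN s1.
apply: le_trans (ler_norm _); apply: le_trans (ler_norm_sum _ _ _) _.
rewrite /M mulr_sumr [leRHS](bigID (fun k : 'I_t.1.+1 => k != node t :> nat)) /=.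
have b0 k : 0 <= bweight p q t.1 k by rewrite bweight_ge0 ?ltW.
have z1 k : 1 <= spread t k by rewrite /spread (le_trans s1) // lerDl.
have z0 k : 0 < spread t k by rewrite (lt_le_trans ltr01).
rewrite -[leLHS]addr0; apply: lerD; last first.
  apply: sumr_ge0 => k _; apply: mulr_ge0; first exact: mulr_ge0.
  by apply: mulr_ge0; [exact: b0 | rewrite exprn_ge0 // ltW].
apply: ler_sum => k km; have kN : (k <= t.1)%N by rewrite -ltnS.
have h := hC t.1 k _ _ kN iN s1 (sqr_sqrtN t) (erefl (spread t k)).
rewrite exprS mulrCA [leLHS]mulrC ler_pM2l // in h.
rewrite normrM [X in X * _]normrM (ger0_norm (b0 k)) normfV.
have -> : 2 * C * (bweight p q t.1 k * spread t k ^+ i) =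
  bweight p q t.1 k * (C * spread t k ^+ i) * 2 by ring.
have cz : 0 <= C * spread t k ^+ i by rewrite mulr_ge0 // exprn_ge0 // ltW.
apply: ler_pM; rewrite ?invr_ge0 //; first exact: (mulr_ge0 (b0 _)).
  by rewrite ler_wpM2l.
by rewrite -[2]invrK lef_pV2 ?posrE ?invr_gt0 //;
  [exact: node_sep | rewrite normr_gt0 subr_eq0 node_uniq].
Qed.

(** In (x - Nq) / (x - k) = 1 + (k - Nq) / (x - k) the second part is expanded by the
three-term recurrence; the first one gives the mean of the dual polynomial
without its value at the nearest node. *)
Lemma restsum_rec i : \forall t \near uniformly D,
  t.1%:R * (t.2 - q) * restsum i.+1 t =
  ((i == 0)%:R - bweight p q t.1 (node t) * dualK p q t.1 i.+1 (node t))
  + p * q * i.+1%:R * restsum i.+2 t + (p - q) * i%:R * restsum i.+1 t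
  + (t.1%:R - i%:R + 1) * restsum i t.
Proof.
apply: filterS2 near01 (near_ge i.+1) => t y01 iN.
have [y0 y1] := andP y01.
have mN := node_le t y01.
have := dualK_mean p q t.1 i pN0 qN0 pq1 (ltnW iN).
rewrite (bigD1 (Ordinal (mN : (node t < t.1.+1)%N))) //= => <-.
rewrite [in RHS](addrAC (bweight _ _ _ _ * _)) subrr add0r.
rewrite /restsum !mulr_sumr -!big_split /=; apply: eq_bigr => k km.
have kN : (k <= t.1)%N by rewrite -ltnS.
have e := dualK_rec p q t.1 i k pN0 qN0 pq1 iN kN.
have xk : t.2 * t.1%:R - k%:R != 0 by rewrite subr_eq0 node_uniq.
set b := bweight _ _ _ _.
have -> : p * q * i.+1%:R * (b * dualK p q t.1 i.+2 k / (t.2 * t.1%:R - k%:R)) =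
  b * (p * q * i.+1%:R * dualK p q t.1 i.+2 k) / (t.2 * t.1%:R - k%:R) by ring.
rewrite e; field => //.
Qed.

Lemma node_far : \forall t \near uniformly D,
  t.1%:R * (delta / 2) <= `|(node t)%:R - t.1%:R * q|.
Proof.
have h : \forall N \near \oo, (delta^-1 <= N%:R :> R) by exact: nbhs_infty_ger.
apply: filterS3 near01 nearq (uniformly_fst D _ h) => t /andP[y0 _] yq hN.
have := offset_le t y0; rewrite /offset => ho.
have -> : (node t)%:R - t.1%:R * q = t.1%:R * (t.2 - q) - (t.2 * t.1%:R - (node t)%:R).
  by ring.
apply: le_trans (lerB_dist _ _); rewrite normrM normr_nat.
have : 1 <= t.1%:R * delta by rewrite -ler_pdivrMr // div1r.
have : t.1%:R * delta <= t.1%:R * `|t.2 - q| by rewrite ler_wpM2l.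
rewrite mulrA; move: (t.1%:R * delta) (t.1%:R * `|_|) `|_ - _| ho => u v w; lra.
Qed.

(** The nearest node is at distance of order N from the mean Nq, so a moment of
order 2d bounds its probability by N^(-d). *)
Lemma order_bweight_node d :
  O 0 (fun t => t.1%:R ^+ d * bweight p q t.1 (node t)).
Proof.
apply: (@order_le_cancel _ _ 0 (d + d)).
pose M t := \sum_(k < t.1.+1) bweight p q t.1 k * spread t k ^+ (d + d).
apply: (@order_le_dom _ _ _ _ (fun t => ((delta / 2)^-1 ^+ (d + d)) * M t)); last first.
  rewrite addn0.
  by apply: (order_leM _ 0); [exact: order_le_cst | exact: order_moment].
apply: filterS2 near01 node_far => t y01 far.
have mN := node_le t y01.
have b0 k : 0 <= bweight p q t.1 k by rewrite bweight_ge0 ?ltW.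
have z0 k : 0 <= spread t k by rewrite addr_ge0 ?sqrtr_ge0.
apply: le_trans (ler_norm _).
rewrite ger0_norm; last first.
  apply: mulr_ge0; first by rewrite exprn_ge0 ?sqrtr_ge0.
  by apply: mulr_ge0; [rewrite exprn_ge0 | exact: b0].
rewrite /M (bigD1 (Ordinal (mN : (node t < t.1.+1)%N))) //= mulrDr.
rewrite ler_wpDr //.
  rewrite mulr_ge0 ?exprn_ge0 ?invr_ge0 ?divr_ge0 ?(ltW delta0) //.
  by apply: sumr_ge0 => k _; apply: mulr_ge0; rewrite ?b0 ?exprn_ge0.
rewrite [leRHS]mulrCA [leLHS]mulrA [leLHS]mulrC ler_wpM2l //.
have -> : sqrtN t ^+ (d + d) * t.1%:R ^+ d = t.1%:R ^+ (d + d).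
  by rewrite [RHS]exprD addnn -mul2n exprM sqr_sqrtN.
rewrite -exprMn lerXn2r ?nnegrE ?mulr_ge0 ?invr_ge0 ?divr_ge0 ?(ltW delta0) //.
rewrite [leRHS]mulrC ler_pdivlMr ?divr_gt0 //.
by rewrite (le_trans far) // /spread lerDr sqrtr_ge0.
Qed.

Lemma order_dualK_node i : O (i + i) (fun t => dualK p q t.1 i.+1 (node t)).
Proof.
have [C C0 hC] := dualK_bound p q p0 q0 pq1 i.+1.
exists (C * 2 ^+ i).
apply: filterS3 near01 (near_ge i) (sqrtN_large D 1) => t y01 iN s1.
have mN := node_le t y01.
have z1 : 1 <= spread t (node t) by rewrite /spread (le_trans s1) // lerDl.
have z0 : 0 < spread t (node t) by rewrite (lt_le_trans ltr01).
have h := hC t.1 _ _ _ mN iN s1 (sqr_sqrtN t) (erefl (spread t (node t))).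
rewrite exprS mulrCA [leLHS]mulrC ler_pM2l // in h.
apply: le_trans h _; rewrite -mulrA ler_wpM2l //.
have -> : sqrtN t ^+ (i + i) = t.1%:R ^+ i by rewrite addnn -mul2n exprM sqr_sqrtN.
rewrite -exprMn lerXn2r ?nnegrE ?(ltW z0) ?mulr_ge0 //.
have s2 : sqrtN t <= t.1%:R by rewrite -sqr_sqrtN expr2 ler_peMl ?sqrtr_ge0.
have : `|(node t)%:R - t.1%:R * q| <= t.1%:R.
  have q1 : 0 <= q <= 1 by move: p0 q0 pq1 => *; apply/andP; split; lra.
  have h1 : t.1%:R * q <= t.1%:R by rewrite ler_piMr //; case/andP: q1.
  have h2 : 0 <= t.1%:R * q by rewrite mulr_ge0 //; case/andP: q1.
  have h3 : (node t)%:R <= t.1%:R :> R by rewrite ler_nat.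
  have h4 : 0 <= (node t)%:R :> R by [].
  by rewrite ler_norml; apply/andP; split; lra.
by rewrite /spread; lra.
Qed.

End Estimates.

(** * Leading behaviour of the pieces *)

Section CloseToOne.
Context {R : realType} (D : set R).
Implicit Types f g : nat * R -> R.

(** f = 1 + O(1/N), uniformly. *)
Definition close1 f := order_le D 0 (fun t => t.1%:R * (f t - 1)).

Lemma order_le_close1 f : close1 f -> order_le D 0 f.
Proof.
move=> h; have h2 : order_le D 0 (fun t => f t - 1).
  by apply: order_le_cancelN; apply: (order_leW D 0 2).
apply: order_le_eq (order_leD _ _ _ _ h2 (order_le_cst D 1)).
by apply: nearW => t; rewrite subrK.
Qed.

Lemma close1M f g : close1 f -> close1 g -> close1 (fun t => f t * g t).
Proof.
move=> hf hg.
apply: order_le_eq (order_leD _ _ _ _ (order_leM _ 0 0 _ _ hf (order_le_close1 _ hg)) hg).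
by apply: nearW => t; ring.
Qed.

Lemma close1_cst1 : close1 (fun=> 1).
Proof.
by apply: order_le_eq (order_le_cst D 0); apply: nearW => t; rewrite subrr mulr0.
Qed.

Lemma close1_prod n (F : nat -> nat * R -> R) : (forall i, close1 (F i)) ->
  close1 (fun t => \prod_(i < n) F i t).
Proof.
move=> hF; elim: n => [|n ih].
  by apply: order_le_eq close1_cst1; apply: nearW => t; rewrite big_ord0.
apply: order_le_eq (close1M _ _ ih (hF n)).
by apply: nearW => t; rewrite big_ord_recr.
Qed.

Lemma close1_near f (e : R) : 0 < e -> close1 f ->
  \forall t \near uniformly D, `|f t - 1| <= e.
Proof. exact: order_le_smallN. Qed.
End CloseToOne.

Section Asymptotics.
Context {R : realType}.
Variables (p q : R) (D : set R) (delta b : R).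
Hypotheses (p0 : 0 < p) (q0 : 0 < q) (pq1 : p + q = 1) (delta0 : 0 < delta).
Hypothesis D01 : forall y, D y -> 0 <= y <= b.
Hypothesis b1 : b < 1.
Hypothesis Dq : forall y, D y -> delta <= `|y - q|.
Local Notation O := (order_le D).

Let D01' : forall y, D y -> 0 <= y <= 1.
Proof. by move=> y /D01/andP[-> /le_trans h]; rewrite h // ltW. Qed.

Let near01 : \forall t \near uniformly D, 0 <= t.2 <= 1.
Proof. exact: uniformly_snd D01'. Qed.

Let nearb : \forall t \near uniformly D, 1 - b <= 1 - t.2.
Proof.
by apply: (uniformly_snd D (fun y => 1 - b <= 1 - y)) => y /D01/andP[_ h]; rewrite lerB.
Qed.

Let nearq : \forall t \near uniformly D, delta <= `|t.2 - q|.
Proof. exact: uniformly_snd Dq. Qed.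

Let near_ge j : \forall t \near uniformly D, (j <= t.1)%N.
Proof. exact: (uniformly_fst D _ (nbhs_infty_ge j)). Qed.

Let c_neq0 : \forall t \near uniformly D, t.2 - q != 0.
Proof. by apply: filterS nearq => t h; rewrite -normr_gt0 (lt_le_trans delta0). Qed.

Let Oc : O 0 (fun t => t.2 - q).
Proof.
apply: (order_le_bounded _ _ 1); apply: filterS near01 => t /andP[h1 h2].
by move: p0 q0 pq1 => h3 h4 h5; rewrite ler_norml; apply/andP; split; lra.
Qed.

Let OcV : O 0 (fun t => (t.2 - q)^-1).
Proof.
apply: (order_le_bounded _ _ delta^-1); apply: filterS2 nearq c_neq0 => t h h0.
by rewrite normfV lef_pV2 ?posrE ?normr_gt0.
Qed.

Lemma order_bweight_absorb d (g : nat * R -> R) : O (d + d) g ->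
  O 0 (fun t => bweight p q t.1 (node t) * g t).
Proof.
move=> Og; apply: (order_le_cancel _ 0 (d + d)); rewrite addn0.
have h := order_bweight_node p q D delta p0 q0 pq1 delta0 D01' Dq d.
apply: order_le_eq (order_leM _ 0 _ _ _ h Og); apply: nearW => t.
by rewrite addnn -mul2n exprM sqr_sqrtN mulrA.
Qed.

(** [bootstrap] for the normalised sums, with initial value 1 and with the error
term due to the nearest node, which is negligible. *)
Lemma restsum_asymptotics i :
  close1 D (fun t => t.1.+1%:R * restsum p q i.+1 t * (t.2 - q) ^+ i.+1).
Proof.
(* The term at k = 0 makes the recurrence start from the constant 1: the sum of
   index 0 vanishes, and the mean of the dual polynomial of degree 0 is 1. *)
pose V (k : nat) (t : nat * R) : R := (k == 0)%:R + t.1.+1%:R * restsum p q k t.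
pose eps (k : nat) (t : nat * R) : R := - (bweight p q t.1 (node t) *
  (t.1.+1%:R * dualK p q t.1 k.+1 (node t))).
have O1 : O 2 (fun t => t.1.+1%:R).
  apply: order_le_eq (order_leD _ _ _ _ (order_le_N D) (order_leW _ 0 2 _ isT (order_le_cst D 1))).
  by apply: nearW => t; rewrite natr1.
have rs0 t : restsum p q 0 t = 0.
  rewrite /restsum big1 // => k _; rewrite dualK0 ?mulr0 ?mul0r //.
  by rewrite -ltnS.
have V0 t : V 0%N t = 1 by rewrite /V rs0 mulr0 addr0.
have crude k : O k.+1 (V k).
  case: k => [|k].
    apply: order_le_eq (order_leW _ 0 1 _ isT (order_le_cst D 1)).
    by apply: nearW => t; rewrite V0.
  have := order_restsum p q D p0 q0 pq1 D01' k => h.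
  apply: order_le_eq (order_leM _ 2 k _ _ O1 h).
  by apply: nearW => t; rewrite /V add0r.
have Oeps k : O 0 (eps k).
  apply: order_leN; apply: (order_bweight_absorb k.+1).
  rewrite [(k.+1 + k.+1)%N](_ : _ = (2 + (k + k))%N); last by lia.
  exact: order_leM O1 (order_dualK_node p q D p0 q0 pq1 D01' k).
have rec k : \forall t \near uniformly D,
    t.1%:R * (t.2 - q) * V k.+1 t = (t.1%:R - k%:R + 1) * V k t
     + (p - q) * k%:R * V k.+1 t + p * q * k.+1%:R * V k.+2 t + eps k t.
  apply: filterS (restsum_rec p q D p0 q0 pq1 D01' k) => t.
  rewrite /V /eps !add0r.
  set A := restsum _ _ k.+1 t; set B := restsum _ _ k t; set C := restsum _ _ k.+2 t.
  set w := bweight _ _ _ _; set s := dualK _ _ _ _ _ => h.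
  transitivity (t.1.+1%:R * (t.1%:R * (t.2 - q) * A)); first by ring.
  rewrite h -(natr1 t.1); case: (k) => [|k'] /=; ring.
have := bootstrap D p q (fun t => t.2 - q) V eps c_neq0 OcV V0 crude Oeps rec i.+1.
move=> h; apply: order_le_eq (order_leM _ 0 0 _ _ h (order_leX D _ i.+1 Oc)).
apply: filterS c_neq0 => t c0; rewrite /V add0r exprVn.
by field; rewrite expf_neq0.
Qed.

(** Leading part of the dual polynomial of degree i at the nearest node. *)
Definition dualK_lead i (t : nat * R) : R :=
  'C(t.1, i)%:R * ((t.2 - q) / (p * q)) ^+ i.

Lemma dualK_leadS i t : (i <= t.1)%N -> p * q * i.+1%:R * dualK_lead i.+1 t =
  (t.1%:R - i%:R) * (t.2 - q) * dualK_lead i t.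
Proof.
move=> it; rewrite /dualK_lead exprS.
have := congr1 (fun n => n%:R : R) (mul_bin_left t.1 i); rewrite !natrM natrB // => e.
set c := t.2 - q; set z := (_ / _) ^+ i.
transitivity (i.+1%:R * 'C(t.1, i.+1)%:R * c * z).
  by field; rewrite !gt_eqF.
rewrite e; ring.
Qed.

Lemma dualK_lead_neq0 i t : (i <= t.1)%N -> t.2 - q != 0 -> dualK_lead i t != 0.
Proof.
move=> it c0; have pq0 : p * q != 0 by rewrite gt_eqF // mulr_gt0.
by rewrite mulf_neq0 ?pnatr_eq0 -?lt0n ?bin_gt0 // expf_neq0 // mulf_neq0 // invr_eq0.
Qed.

Lemma order_dualK_lead i : O (i + i) (dualK_lead i).
Proof.
elim: i => [|i ih].
  apply: order_le_eq (order_le_cst D 1); apply: nearW => t.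
  by rewrite /dualK_lead bin0 expr0 mulr1.
pose g (t : nat * R) := (p * q * i.+1%:R)^-1 * (t.2 - q) * ((t.1%:R - i%:R) * dualK_lead i t).
apply: (order_le_eq _ _ _ g).
  apply: filterS (near_ge i) => t it; have e := dualK_leadS i t it.
  have -> : g t = (p * q * i.+1%:R)^-1 * ((t.1%:R - i%:R) * (t.2 - q) * dualK_lead i t).
    by rewrite /g; ring.
  by rewrite -e mulKf // gt_eqF // !mulr_gt0.
rewrite (_ : (i.+1 + i.+1 = 0 + (2 + (i + i)))%N); last by lia.
apply: order_leM; first exact: (order_leM _ 0 0 _ _ (order_le_cst _ _) Oc).
apply: order_leM => //; apply: order_leB; first exact: order_le_N.
by apply: (order_leW _ 0 2) => //; exact: order_le_cst.
Qed.

Lemma order_dualK_lead_inv i : O 0 (fun t => t.1%:R ^+ i / dualK_lead i t).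
Proof.
elim: i => [|i ih].
  apply: order_le_eq (order_le_cst D 1); apply: nearW => t.
  by rewrite /dualK_lead bin0 !expr0 mulr1 divr1.
pose g (t : nat * R) := (t.1%:R ^+ i / dualK_lead i t) * ((p * q * i.+1%:R) *
   ((t.2 - q)^-1 * (t.1%:R / (t.1%:R - i%:R)))).
apply: (order_le_eq _ _ _ g).
  apply: filterS2 (near_ge i.+1) c_neq0 => t it c0.
  have e := dualK_leadS i t (ltnW it).
  have Ni : t.1%:R - i%:R != 0 :> R by rewrite -natrB 1?ltnW // pnatr_eq0 subn_eq0 -ltnNge.
  have l0 := dualK_lead_neq0 i t (ltnW it) c0.
  have K0 : p * q * i.+1%:R != 0 by rewrite gt_eqF // !mulr_gt0.
  have -> : dualK_lead i.+1 t = (t.1%:R - i%:R) * (t.2 - q) * dualK_lead i t / (p * q * i.+1%:R).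
    by rewrite -e mulrC mulKf.
  rewrite /g exprS; set z := dualK_lead i t in l0 *; set K := p * q * _ in K0 *.
  by field; rewrite K0 l0 Ni c0.
apply: (order_leM _ 0 0) => //; apply: (order_leM _ 0 0); first exact: order_le_cst.
apply: (order_leM _ 0 0) => //; apply: (order_le_bounded _ _ 2).
apply: filterS (near_ge (i.*2).+1) => t it.
have h : i%:R *+ 2 + 1 <= t.1%:R :> R by rewrite -mulr_natr -natrM natr1 ler_nat muln2.
have i0 : 0 <= i%:R :> R by [].
have Ni : 0 < t.1%:R - i%:R :> R by move: h; rewrite mulr2n; lra.
rewrite ger0_norm ?divr_ge0 ?(ltW Ni) // ler_pdivrMr //.
by move: h; rewrite mulr2n; lra.
Qed.

(** Both sequences satisfy the same recurrence to leading order: of the three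
terms, only the one with N c has full size, because theta is bounded and the
term two steps back lacks a factor N. *)
Lemma order_dualK_diff i :
  O (i + i) (fun t => t.1%:R * (dualK p q t.1 i.+1 (node t) - dualK_lead i t)).
Proof.
elim: i => [|i ih].
  apply: order_le_eq (order_le_cst D 0); apply: filterS near01 => t y01.
  by rewrite dualK1 ?gt_eqF ?node_le // /dualK_lead bin0 expr0 mulr1 subrr mulr0.
pose s k (t : nat * R) : R := dualK p q t.1 k (node t).
pose g (t : nat * R) := (p * q * i.+1%:R)^-1 * (
  (t.2 - q) * (t.1%:R * (t.1%:R * (s i.+1 t - dualK_lead i t)))
  + t.1%:R * (i%:R * ((t.2 - q) * dualK_lead i t)
     - (offset t + (p - q) * i%:R) * s i.+1 t)
  - (t.1%:R - i%:R + 1) * (t.1%:R * s i t)).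
apply: (order_le_eq _ _ _ g).
  apply: filterS2 near01 (near_ge i.+1) => t y01 it.
  have K0 : p * q * i.+1%:R != 0 by rewrite gt_eqF // !mulr_gt0.
  have e1 := dualK_leadS i t (ltnW it).
  have e2 := dualK_rec p q t.1 i (node t) (lt0r_neq0 p0) (lt0r_neq0 q0) pq1 it (node_le t y01).
  rewrite -[LHS](mulKf K0) /g; congr (_ * _).
  transitivity (t.1%:R * (p * q * i.+1%:R * dualK p q t.1 i.+2 (node t)
     - p * q * i.+1%:R * dualK_lead i.+1 t)); first by ring.
  by rewrite e1 e2 /s /offset; ring.
have Os k : O (k + k) (s k.+1) := order_dualK_node p q D p0 q0 pq1 D01' k.
have lift2 f : O (i + i) f -> O (i.+1 + i.+1) (fun t => t.1%:R * f t).
  move=> h; rewrite (_ : (i.+1 + i.+1 = 2 + (i + i))%N); last by lia.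
  by apply: order_leM => //; exact: order_le_N.
have c0 f d : O d f -> forall K : R, O d (fun t => K * f t).
  by move=> h K; apply: (order_leM _ 0 d) => //; exact: order_le_cst.
apply: (c0); apply: order_leB.
  apply: order_leD.
    by apply: (order_leM _ 0 (i.+1 + i.+1)) => //; apply: lift2.
  apply: lift2; apply: order_leB.
    by apply: (c0); apply: (order_leM _ 0) => //; exact: order_dualK_lead.
  apply: (order_leM _ 0) => //; apply: order_leD; last exact: order_le_cst.
  apply: (order_le_bounded _ _ 2^-1); apply: filterS near01 => t /andP[y0 _].
  exact: offset_le.
case: (i) => [|k].
  apply: order_le_eq (order_leW _ 0 2 _ isT (order_le_cst D 0)).
  by apply: filterS near01 => t y01; rewrite /s dualK0 ?mulr0 // node_le.
rewrite (_ : (k.+2 + k.+2 = 2 + (2 + (k + k)))%N); last by lia.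
apply: order_leM; last by apply: order_leM => //; exact: order_le_N.
apply: order_leD; last by apply: (order_leW _ 0 2) => //; exact: order_le_cst.
apply: order_leB; first exact: order_le_N.
by apply: (order_leW _ 0 2) => //; exact: order_le_cst.
Qed.

Lemma dualK_asymptotics i :
  close1 D (fun t => dualK p q t.1 i.+1 (node t) / dualK_lead i t).
Proof.
have h := order_leM _ _ _ _ _ (order_dualK_diff i) (order_dualK_lead_inv i).
apply: (order_le_cancel _ 0 (i + i)); apply: order_le_eq h.
apply: filterS2 (near_ge i) c_neq0 => t it c0.
have -> : sqrtN t ^+ (i + i) = t.1%:R ^+ i by rewrite addnn -mul2n exprM sqr_sqrtN.
have l0 := dualK_lead_neq0 i t it c0.
by set z := dualK_lead i t in l0 *; set w := dualK _ _ _ _ _; field.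
Qed.

(** Ratio of C(x, N+1) to (y - 1)^(j+1) C(x, N - j). *)
Definition binom_shift j (t : nat * R) : R :=
  \prod_(i < j.+1) ((t.1%:R - j%:R + i%:R - t.2 * t.1%:R) /
     ((t.1%:R - j%:R + i%:R + 1) * (1 - t.2))).

Lemma binomR_shift j : \forall t \near uniformly D,
  binomR (t.2 * t.1%:R) t.1.+1 =
  binomR (t.2 * t.1%:R) (t.1 - j)%N * (t.2 - 1) ^+ j.+1 * binom_shift j t.
Proof.
apply: filterS2 nearb (near_ge j) => t hb jt.
have y1 : 1 - t.2 != 0 by rewrite gt_eqF // (lt_le_trans _ hb) // subr_gt0.
have step n (x : R) : binomR x n.+1 = binomR x n * ((x - n%:R) / n.+1%:R).
  rewrite /binomR big_ord_recr /= factS natrM.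
  have f0 : (n`!%:R : R) != 0 by rewrite pnatr_eq0 -lt0n fact_gt0.
  by field; rewrite f0 addrC natr1 pnatr_eq0.
have gen k n (x : R) : binomR x (n + k)%N = binomR x n * \prod_(i < k) ((x - (n + i)%:R) / (n + i).+1%:R).
  elim: k => [|k ih]; first by rewrite addn0 big_ord0 mulr1.
  by rewrite addnS step ih -mulrA; congr (_ * _); rewrite big_ord_recr.
have -> : (t.1.+1 = (t.1 - j) + j.+1)%N by rewrite addnS subnK.
rewrite gen -[RHS]mulrA; congr (_ * _).
rewrite /binom_shift -[X in _ ^+ X](card_ord j.+1) -prodr_const -big_split /=.
apply: eq_bigr => i _.
rewrite -natr1 natrD natrB //.
have n0 : t.1%:R - j%:R + i%:R + 1 != 0 :> R by rewrite -natrB // -natrD natr1 pnatr_eq0.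
by field; rewrite y1 n0.
Qed.

Lemma binom_shift_close1 j : close1 D (binom_shift j).
Proof.
apply: (close1_prod D j.+1 (fun i t => (t.1%:R - j%:R + i%:R - t.2 * t.1%:R) /
     ((t.1%:R - j%:R + i%:R + 1) * (1 - t.2)))) => i.
pose g (t : nat * R) := (t.1%:R / (t.1%:R - j%:R + i%:R + 1)) *
  ((i%:R - j%:R - (i%:R - j%:R + 1) * (1 - t.2)) * (1 - t.2)^-1).
apply: (order_le_eq _ _ _ g).
  apply: filterS2 nearb (near_ge j) => t hb jt.
  have y1 : 1 - t.2 != 0 by rewrite gt_eqF // (lt_le_trans _ hb) // subr_gt0.
  have n0 : t.1%:R - j%:R + i%:R + 1 != 0 :> R.
    by rewrite -natrB // -natrD natr1 pnatr_eq0.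
  by rewrite /g; field; rewrite y1 n0.
apply: (order_leM _ 0 0).
  apply: (order_le_bounded _ _ 2); apply: filterS (near_ge j.*2) => t jt.
  have h : j%:R + j%:R <= t.1%:R :> R by rewrite -natrD ler_nat addnn.
  have j0 : 0 <= j%:R :> R by [].
  have i0 : 0 <= i%:R :> R by [].
  have n0 : 0 < t.1%:R - j%:R + i%:R + 1 :> R by lra.
  rewrite ger0_norm ?divr_ge0 ?(ltW n0) // ler_pdivrMr //; lra.
have O1y : O 0 (fun t => 1 - t.2).
  apply: (order_le_bounded _ _ 1); apply: filterS near01 => t /andP[y0 y1].
  by rewrite ler_norml; apply/andP; split; lra.
apply: (order_leM _ 0 0).
  apply: order_leB; first exact: order_le_cst.
  by apply: (order_leM _ 0 0) => //; exact: order_le_cst.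
apply: (order_le_bounded _ _ (1 - b)^-1); apply: filterS nearb => t h.
have h0 : 0 < 1 - b by rewrite subr_gt0.
by rewrite normfV lef_pV2 ?posrE ?normr_gt0 ?gt_eqF ?(lt_le_trans h0) // (le_trans h) ?ler_norm.
Qed.

End Asymptotics.

(** * The basis polynomial of the nearest node and the trigonometric factor *)

Section NearestBasisPolynomial.
Context {R : realType}.
Implicit Types (h x : R) (t : nat * R).

(** The lower bounds telescope to 1 / (n + 1). *)
Lemma prod_telescope n (g : nat -> R) :
  (forall i, (i < n)%N -> i.+1%:R / i.+2%:R <= g i) ->
  n.+1%:R^-1 <= \prod_(i < n) g i.
Proof.
elim: n => [|n ih] hg; first by rewrite big_ord0 invr1.
rewrite big_ord_recr /=.
have -> : n.+2%:R^-1 = n.+1%:R^-1 * (n.+1%:R / n.+2%:R) :> R.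
  by rewrite mulKf // pnatr_eq0.
apply: ler_pM; rewrite ?invr_ge0 ?divr_ge0 //; last exact: hg.
by apply: ih => i ni; apply: hg; rewrite ltnW.
Qed.

Lemma prod_close1 n (g : nat -> R) h : 0 <= h -> n%:R * h <= 2^-1 ->
  (forall i, (i < n)%N -> `|g i - 1| <= h) ->
  `|\prod_(i < n) g i - 1| <= 2 * n%:R * h.
Proof.
move=> h0; elim: n => [|n ih] hn hg.
  by rewrite big_ord0 subrr normr0 mulr0 mul0r.
have hn' : n%:R * h <= 2^-1 by apply: le_trans hn; rewrite ler_wpM2r // ler_nat.
have {ih} := ih hn' (fun i ni => hg i (ltnW ni)).
have := hg n (ltnSn n); rewrite big_ord_recr /= -(natr1 n).
set P := \prod_(_ < _) _ => gn hP.
have -> : P * g n - 1 = (P - 1) * (g n - 1) + (P - 1) + (g n - 1) by ring.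
apply: le_trans (ler_normD _ _) _; apply: le_trans (lerD (ler_normD _ _) (lexx _)) _.
rewrite normrM.
have : `|P - 1| * `|g n - 1| <= 1 * h.
  apply: ler_pM => //; apply: le_trans hP _.
  by rewrite -mulrA; lra.
rewrite mul1r mulrDr mulr1 mulrDl.
move: (`|P - 1| * _) hP => z; lra.
Qed.

Lemma lagrangeR_node t : 0 <= t.2 <= 1 ->
  lagrangeR t.1 (node t) (t.2 * t.1%:R) =
  (\prod_(i < node t) (1 + offset t / ((node t)%:R - i%:R))) *
  \prod_(i < t.1 - node t) (1 - offset t / i.+1%:R).
Proof.
move=> y01; have mN := node_le t y01.
rewrite /lagrangeR (prod_skip _ _ (fun i => (t.2 * t.1%:R - i%:R) / ((node t)%:R - i%:R))) //.
congr (_ * _); apply: eq_bigr => i _; rewrite /offset.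
  have ne : (node t)%:R - i%:R != 0 :> R.
    by rewrite subr_eq0 eqr_nat gtn_eqF.
  by field.
have i1 : i.+1%:R != 0 :> R by rewrite pnatr_eq0.
have -> : (node t)%:R - (node t + i.+1)%:R = - i.+1%:R :> R.
  by rewrite natrD opprD addrA subrr add0r.
by rewrite natrD; field; rewrite addrC natr1.
Qed.

(** Since |theta| <= 1/2, the factor of a node at distance i + 1 is at least
1 - 1/(2(i + 1)) >= (i + 1)/(i + 2); both sides of the nearest node contribute a
telescoping product. *)
Lemma lagrangeR_node_lower t : 0 <= t.2 <= 1 ->
  (t.1.+1%:R ^+ 2)^-1 <= lagrangeR t.1 (node t) (t.2 * t.1%:R).
Proof.
move=> y01; have mN := node_le t y01; have [y0 y1] := andP y01.
have ho := offset_le t y0.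
have factor (i : nat) (z : R) : `|z| <= 2^-1 -> i.+1%:R / i.+2%:R <= 1 + z / i.+1%:R.
  rewrite ler_norml => /andP[h1 h2].
  rewrite -(natr1 i.+1) -(natr1 i).
  set n : R := i%:R; have n0 : 0 <= n by [].
  have p1 : 0 < n + 1 by lra.
  have p2 : 0 < n + 1 + 1 by lra.
  rewrite ler_pdivrMr //.
  have -> : (1 + z / (n + 1)) * (n + 1 + 1) = (n + 1 + 1) + z + z / (n + 1).
    by field; rewrite gt_eqF.
  have : - 2^-1 <= z / (n + 1).
    rewrite ler_pdivlMr //; have : - 2^-1 * (n + 1) <= - 2^-1 by lra.
    lra.
  lra.
rewrite lagrangeR_node //.
have l1 : (node t).+1%:R^-1 <= \prod_(i < node t) (1 + offset t / ((node t)%:R - i%:R)).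
  rewrite (reindex_inj rev_ord_inj) /=.
  apply: (prod_telescope _ (fun i => 1 + offset t / ((node t)%:R - (node t - i.+1)%:R))).
  move=> i im; have -> : (node t)%:R - (node t - i.+1)%:R = i.+1%:R :> R.
    by rewrite natrB // opprB addrC subrK.
  exact: factor.
have l2 : (t.1 - node t).+1%:R^-1 <= \prod_(i < t.1 - node t) (1 - offset t / i.+1%:R).
  apply: (prod_telescope _ (fun i => 1 - offset t / i.+1%:R)) => i _.
  by rewrite -mulNr; apply: factor; rewrite normrN.
apply: le_trans (ler_pM _ _ l1 l2); rewrite ?invr_ge0 //.
by rewrite expr2 invfM ler_pM ?invr_ge0 // lef_pV2 ?posrE // ler_nat ltnS // leq_subr.
Qed.

Lemma lagrangeR_node_close1 t : 0 <= t.2 <= 1 ->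
  t.1.+1%:R * `|offset t| <= 2^-1 ->
  `|lagrangeR t.1 (node t) (t.2 * t.1%:R) - 1| <= 2 * t.1.+1%:R * `|offset t|.
Proof.
move=> y01 small; have mN := node_le t y01.
rewrite /lagrangeR big_mkcond /=.
apply: (prod_close1 _ (fun i => if i != node t then
  (t.2 * t.1%:R - i%:R) / ((node t)%:R - i%:R) else 1)) => // i iN.
case: ifPn => [im|_]; last by rewrite subrr normr0.
have ne : (node t)%:R - i%:R != 0 :> R by rewrite subr_eq0 eqr_nat eq_sym.
have -> : (t.2 * t.1%:R - i%:R) / ((node t)%:R - i%:R) - 1 =
   offset t / ((node t)%:R - i%:R) by rewrite /offset; field.
rewrite normrM normfV ler_piMr // invf_le1 ?normr_gt0 //.
move: im; rewrite neq_ltn => /orP[im|im]; last rewrite distrC.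
  by rewrite -natrB 1?ltnW // normr_nat ler1n subn_gt0.
by rewrite -natrB 1?ltnW // normr_nat ler1n subn_gt0.
Qed.

(** The full product over the nodes is theta times the numerator of the basis
polynomial of the nearest node; that polynomial is positive at x. *)
Lemma binomR_node t : 0 <= t.2 <= 1 ->
  `|binomR (t.2 * t.1%:R) t.1.+1| * (t.1.+1%:R * 'C(t.1, node t)%:R) =
  `|offset t| * lagrangeR t.1 (node t) (t.2 * t.1%:R).
Proof.
move=> y01; have mN := node_le t y01.
have e := congr1 Num.norm (lagrangeR_nearest t.1 (node t) (t.2 * t.1%:R) mN).
have l0 : 0 <= lagrangeR t.1 (node t) (t.2 * t.1%:R).
  by apply: le_trans (lagrangeR_node_lower t y01); rewrite invr_ge0 exprn_ge0.
rewrite [RHS]normrM [X in _ = X * _]normrM normr_sign mul1r (ger0_norm l0) in e.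
rewrite /offset -e [RHS]normrM mulrC; congr (_ * _).
by rewrite normrM !normr_nat.
Qed.

End NearestBasisPolynomial.

Section TrigFactor.
Context {R : realType}.
Variables (r : R) (r0 : 0 < r).

Lemma trig_factor_bound : exists2 K : R, 0 < K &
  forall x, `|x| <= 1 -> `|r `^ x * cos (pi * x)| <= K.
Proof.
exists (expR `|ln r|); first exact: expR_gt0.
move=> x x1; rewrite normrM -[leRHS]mulr1 ler_pM //; last first.
  by rewrite ler_norml cos_geN1 cos_le1.
rewrite ger0_norm ?powR_ge0 // /powR gt_eqF // ler_expR.
apply: le_trans (ler_norm _) _; rewrite normrM ler_piMl //.
Qed.

Lemma trig_factor_near1 (e : R) : 0 < e -> exists2 eta : R, 0 < eta &
  forall x, `|x| < eta -> `|r `^ x * cos (pi * x) - 1| <= e.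
Proof.
move=> e0.
pose f x := expR (x * ln r) * cos (pi * x).
have f1 : f 0 = 1 by rewrite /f mul0r mulr0 expR0 cos0 mulr1.
have fE x : r `^ x * cos (pi * x) = f x by rewrite /f /powR gt_eqF.
have cf : {for 0, continuous f}.
  apply: continuousM.
    apply: continuous_comp; last exact: continuous_expR.
    by apply: continuousM; [exact: cvg_id | exact: cvg_cst].
  apply: continuous_comp; last exact: continuous_cos.
  by apply: continuousM; [exact: cvg_cst | exact: cvg_id].
have /cvgrPdist_le /(_ e e0) := cf.
rewrite f1 => /nbhs_ballP[eta /= eta0 h]; exists eta => // x xe.
rewrite fE distrC; apply: h; rewrite /ball /= sub0r normrN //.
Qed.
End TrigFactor.

(** * The two-term expansion *)

Section TwoTermExpansion.
Context {R : realType}.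

(** The error is shared between the two terms in proportion to their absolute
values. *)
Lemma approx_sum_le (e f g1 g2 : R) : 0 <= e ->
  `|f - (g1 + g2)| <= e * (`|g1| + `|g2|) -> approx_sum e f g1 g2.
Proof.
move=> e0 h; set r := f - (g1 + g2) in h; set S := `|g1| + `|g2| in h.
have S0 : 0 <= S by rewrite addr_ge0.
have [S00|Sn0] := eqVneq S 0.
  have r0 : r = 0 by apply/eqP; rewrite -normr_le0 (le_trans h) // S00 mulr0.
  exists 0, 0; split; rewrite ?normr0 // !addr0 !mulr1.
  by apply/eqP; rewrite -subr_eq0 -/r r0.
have Sp : 0 < S by rewrite lt_def Sn0.
have sgle (z : R) : `|r * Num.sg z / S| <= e.
  rewrite !normrM normfV (ger0_norm S0) ler_pdivrMr //; apply: le_trans h.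
  by rewrite ler_piMr // normr_sg lern1 leq_b1.
exists (r * Num.sg g1 / S), (r * Num.sg g2 / S); split; rewrite ?sgle //.
have -> : g1 * (1 + r * Num.sg g1 / S) + g2 * (1 + r * Num.sg g2 / S) =
  g1 + g2 + r * (g1 * Num.sg g1 + g2 * Num.sg g2) / S by ring.
rewrite ![_ * Num.sg _]mulrC -!normrEsg -/S mulfK //.
by rewrite /r addrC subrK.
Qed.

Lemma bracket_near (e l r tau : R) : e <= 2^-1 ->
  `|l - 1| <= e -> `|r - 1| <= e -> `|tau - 1| <= e ->
  `|l * r - tau| <= 8 * e * `|tau|.
Proof.
move=> e2 hl hr ht.
have h3 : `|l * r - tau| <= 4 * e.
  have -> : l * r - tau = (l - 1) * (r - 1) + (l - 1) + (r - 1) - (tau - 1) by ring.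
  apply: le_trans (ler_normB _ _) _.
  have := ler_normD ((l - 1) * (r - 1) + (l - 1)) (r - 1).
  have := ler_normD ((l - 1) * (r - 1)) (l - 1).
  have : `|(l - 1) * (r - 1)| <= 1 * e.
    by rewrite normrM ler_pM // (le_trans hl) // (le_trans e2) // invf_le1 // ler1n.
  lra.
have h2 : 2^-1 <= `|tau|.
  have := ler_normD tau (1 - tau); rewrite addrC subrK normr1 [`|1 - tau|]distrC.
  lra.
have e0 : 0 <= e by apply: le_trans hl.
apply: le_trans h3 _; apply: (@le_trans _ _ (8 * e * 2^-1)); first by lra.
by rewrite ler_wpM2l // mulr_ge0.
Qed.

Lemma norm_le_close (r e : R) : `|r - 1| <= e -> `|r| <= e + 1.
Proof. by have := ler_normD (r - 1) 1; rewrite subrK normr1; lra. Qed.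

Lemma small_offset (N x e : R) : 0 < e -> 4 <= N -> 4 / e <= N -> 0 <= x ->
  x * (N * N) <= 1 -> (N + 1) * x <= 2^-1 /\ 2 * (N + 1) * x <= e.
Proof.
move=> e0 N4 Ne x0 h; have N0 : 0 < N by lra.
have h1 : x * N <= N^-1 by rewrite -div1r ler_pdivlMr // -mulrA.
have h2 : x <= x * N by rewrite ler_peMr //; lra.
have h3 : N^-1 <= 4^-1 by rewrite lef_pV2 ?posrE //; lra.
have h4 : 4 * N^-1 <= e by rewrite ler_pdivrMr // mulrC -ler_pdivrMr.
by split; lra.
Qed.

Lemma dist_le1 (x y : R) : 0 <= x <= 1 -> 0 <= y <= 1 -> `|x - y| <= 1.
Proof. by move=> /andP[? ?] /andP[? ?]; rewrite ler_norml; apply/andP; split; lra. Qed.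

Variables (p q : R) (D : set R) (delta b : R).
Hypotheses (p0 : 0 < p) (q0 : 0 < q) (pq1 : p + q = 1) (delta0 : 0 < delta).
Hypothesis D01 : forall y, D y -> 0 <= y <= b.
Hypothesis b1 : b < 1.
Hypothesis Dq : forall y, D y -> delta <= `|y - q|.

Let D01' : forall y, D y -> 0 <= y <= 1.
Proof. by move=> y /D01/andP[-> /le_trans h]; rewrite h // ltW. Qed.

Definition oscillating_term j (t : nat * R) : R :=
  'C(t.1, j)%:R * (- p) ^+ (t.1 - j) * (q / p) `^ (t.1%:R * t.2)
     * cos (t.1%:R * pi * t.2) * (1 - t.2 / q) ^+ j.

Definition saddle_term j (t : nat * R) : R :=
  binomR (t.1%:R * t.2) (t.1 - j)%N * ((1 - t.2) / (q - t.2)) ^+ j.+1.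

(** Writing x = m + theta, the sign of cos(pi x) and the integral power of q/p
combine with the power of -p into q^m (-p)^(N-m), as in the value at the node m. *)
Lemma oscillating_term_node j t : 0 <= t.2 <= 1 -> (j <= t.1)%N ->
  oscillating_term j t = q ^+ node t * (- p) ^+ (t.1 - node t) * dualK_lead p q j t
    * ((q / p) `^ offset t * cos (pi * offset t)).
Proof.
move=> y01 jt; have mN := node_le t y01.
have pn : p != 0 by rewrite gt_eqF.
have qn : q != 0 by rewrite gt_eqF.
rewrite /oscillating_term /dualK_lead.
have -> : t.1%:R * t.2 = (node t)%:R + offset t by rewrite /offset addrC subrK mulrC.
have -> : t.1%:R * pi * t.2 = pi * offset t + pi *+ node t.
  by rewrite /offset -[_ *+ node t]mulr_natr; ring.
rewrite (alternatingn (@cosDpi R)).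
rewrite powRD; last by rewrite mulf_neq0 ?invr_eq0 ?implybT.
rewrite powR_mulrn ?divr_ge0 ?(ltW p0) ?(ltW q0) //.
set T := _ `^ _; set c := cos _.
have -> : (1 - t.2 / q) = (- p) * ((t.2 - q) / (p * q)) by field; rewrite pn qn.
rewrite [(- p * _) ^+ j]exprMn; set z := (_ / (p * q)) ^+ j.
have -> : (- p) ^+ (t.1 - node t) = (-1) ^+ node t * p ^- node t * (- p) ^+ (t.1 - j) * (- p) ^+ j.
  have e : (- p) ^+ (t.1 - j) * (- p) ^+ j =
      (- p) ^+ (t.1 - node t) * ((-1) ^+ node t * p ^+ node t).
    by rewrite -exprNn -!exprD !subnK.
  have s2 : (-1) ^+ node t * (-1) ^+ node t = 1 :> R by rewrite -expr2 sqrr_sign.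
  rewrite -mulrA e; set X := (- p) ^+ (t.1 - node t).
  transitivity (((-1) ^+ node t * (-1) ^+ node t) * X); first by rewrite s2 mul1r.
  by field; rewrite expf_neq0.
rewrite expr_div_n; ring.
Qed.

(** The sum over the nodes k <> m reproduces the second term up to a relative error, and the
contribution of the nearest node differs from the first one by A L (l r - tau),
with l the basis polynomial, r close to 1 and tau the factor that depends on
theta.  For tiny theta the bracket is small against tau; otherwise the difference
is absorbed by the second term. *)
Lemma krawtchouk_two_terms j (e : R) : 0 < e ->
  \forall t \near uniformly D,
    approx_sum e (krawtchouk p q t.1 (t.1 - j) (t.2 * t.1%:R))
      (oscillating_term j t) (saddle_term j t).
Proof.
move=> e0; pose e1 := e / 2; pose e2 := Num.min 2^-1 (e1 / 8).
have e10 : 0 < e1 by rewrite divr_gt0.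
have e20 : 0 < e2 by rewrite lt_min invr_gt0 ltr0n divr_gt0.
have e2h : e2 <= 2^-1 by rewrite ge_min lexx.
have e28 : e2 <= e1 / 8 by rewrite ge_min lexx orbT.
have qp0 : 0 < q / p by rewrite divr_gt0.
have [K K0 hK] := trig_factor_bound (q / p) qp0.
have [eta eta0 heta] := trig_factor_near1 (q / p) qp0 e2 e20.
have near01 : \forall t \near uniformly D, 0 <= t.2 <= 1 := uniformly_snd D _ D01'.
have nearj := uniformly_fst D _ (nbhs_infty_ge j).
have hr := close1_near D _ e2 e20 (dualK_asymptotics p q D delta b p0 q0 pq1 delta0 D01 b1 Dq j).
have hQ := close1_near D _ 1 ltr01 (binom_shift_close1 D b D01 b1 j).
have hH := close1_near D _ e1 e10 (close1M D _ _
  (binom_shift_close1 D b D01 b1 j)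
  (restsum_asymptotics p q D delta b p0 q0 pq1 delta0 D01 b1 Dq j)).
have nearq : \forall t \near uniformly D, delta <= `|t.2 - q| := uniformly_snd D _ Dq.
have ON := order_le_N D.
have cst d (z : R) : order_le D d (fun=> z).
  by apply: (order_leW _ 0) => //; exact: order_le_cst.
have ON1 : order_le D 2 (fun t => t.1.+1%:R).
  apply: order_le_eq (order_leD _ _ _ _ ON (cst 2 1)).
  by apply: nearW => t; rewrite natr1.
(* Half the size of the difference relative to the second term when
   |theta| > N^(-2); the probability of the nearest node beats the polynomial factors. *)
have hP : \forall t \near uniformly D,
    `|bweight p q t.1 (node t) * (dualK_lead p q j t *
       (t.1%:R * t.1%:R * t.1.+1%:R * (2 + K * (t.1.+1%:R * t.1.+1%:R))))| <= e1 / 2.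
  apply: order_le_smallN; first by rewrite divr_gt0.
  pose g (t : nat * R) := dualK_lead p q j t *
       (t.1%:R * (t.1%:R * t.1%:R * t.1.+1%:R * (2 + K * (t.1.+1%:R * t.1.+1%:R)))).
  apply: (@order_le_eq _ _ _ _ (fun t => bweight p q t.1 (node t) * g t)).
    by apply: nearW => t; rewrite /g; set w := bweight _ _ _ _; set l := dualK_lead _ _ _ _; ring.
  apply: (order_bweight_absorb p q D delta b p0 q0 pq1 delta0 D01 b1 Dq (j + 6)).
  rewrite (_ : (j + 6 + (j + 6) = (j + j) + (2 + (2 + 2 + 2 + (0 + (2 + 2)))))%N); last by rewrite addnACA.
  apply: (order_leM _ (j + j) _ (dualK_lead p q j)).
    exact: (order_dualK_lead p q D delta b p0 q0 pq1 delta0 D01 b1 j).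
  apply: order_leM => //; apply: order_leM.
    by apply: order_leM => //; apply: order_leM.
  apply: order_leD; first exact: cst.
  by apply: order_leM => //; apply: order_leM.
have hS : \forall t \near uniformly D,
    Num.max (4 / e2) (Num.max 4 (2 / eta)) <= t.1%:R :> R.
  exact: (uniformly_fst D _ (nbhs_infty_ger _)).
apply: filterS (filterI hr (filterI hQ (filterI hH (filterI hP (filterI hS
  (filterI near01 (filterI nearj (filterI nearq (binomR_shift D b D01 b1 j)))))))))
  => t [{}hr [{}hQ [{}hH [{}hP [{}hS [y01 [jt [yq]]]]]]]] /= Xeq.
have [y0 y1] := andP y01.
have mN := node_le t y01.
have c0 : t.2 - q != 0 by rewrite -normr_gt0 (lt_le_trans delta0).
have L0 := dualK_lead_neq0 p q p0 q0 j t jt c0.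
have fE := krawtchouk_decomposition p q t.1 j (node t) (t.2 * t.1%:R)
  (lt0r_neq0 p0) (lt0r_neq0 q0) jt mN (fun k _ => node_uniq t k y0).
have g1E := oscillating_term_node j t y01 jt.
have theta := offset_le t y0.
have XE := binomR_node t y01.
have lo := lagrangeR_node_lower t y01.
have near1 := lagrangeR_node_close1 t y01.
have th1 : `|offset t| <= 1 by apply: le_trans theta _; rewrite invf_le1 // ler1n.
have {}hK := hK _ th1.
have {}heta := heta (offset t).
pose A : R := q ^+ node t * (- p) ^+ (t.1 - node t).
set L := dualK_lead p q j t in L0 hr hP g1E.
set sg := dualK p q t.1 j.+1 (node t) in hr fE.
set l := lagrangeR t.1 (node t) (t.2 * t.1%:R) in fE XE lo near1.
set tau := _ `^ _ * _ in hK heta g1E.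
set X := binomR _ t.1.+1 in Xeq fE XE.
set Q := binom_shift j t in hQ hH Xeq.
set W := t.1.+1%:R * _ in hH fE.
set g2 := saddle_term j t.
set Br := binomR (t.2 * t.1%:R) (t.1 - j)%N in Xeq.
set c := t.2 - q in c0 hH.
have g2E : g2 * c ^+ j.+1 = Br * (t.2 - 1) ^+ j.+1.
  rewrite /g2 /saddle_term [t.1%:R * t.2]mulrC -/Br -mulrA -exprMn; congr (_ * _ ^+ _).
  have c0' : q - t.2 != 0 by rewrite -opprB oppr_eq0.
  by rewrite /c; field.
have {}Xeq : X = g2 * c ^+ j.+1 * Q by rewrite g2E.
pose H := Q * (W * c ^+ j.+1).
have {}fE : krawtchouk p q t.1 (t.1 - j) (t.2 * t.1%:R) = A * L * (sg / L) * l + g2 * H.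
  rewrite fE -/A [in X in _ + X * _]Xeq /H; congr (_ + _); last by ring.
  by field.
set r := sg / L in hr fE.
rewrite fE; set g1 := oscillating_term j t in g1E *.
apply: approx_sum_le; first exact: ltW.
(* Half of the admissible error is left to the second term. *)
suff osc : `|A * L * (l * r - tau)| <= e1 * (`|g1| + `|g2|).
  have -> : A * L * r * l + g2 * H - (g1 + g2) = A * L * (l * r - tau) + g2 * (H - 1).
    by rewrite g1E -/A; ring.
  apply: le_trans (ler_normD _ _) _; rewrite [X in _ + X]normrM.
  have h2 : `|g2| * `|H - 1| <= e1 * `|g2| by rewrite mulrC ler_wpM2r.
  have h3 : e * (`|g1| + `|g2|) = e1 * (`|g1| + `|g2|) + e1 * (`|g1| + `|g2|).
    by rewrite /e1; field.
  rewrite h3; apply: lerD => //; apply: le_trans h2 _.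
  by rewrite ler_wpM2l ?(ltW e10) // lerDr.
have nearest_case : `|l * r - tau| <= e1 * `|tau| -> `|A * L * (l * r - tau)| <= e1 * (`|g1| + `|g2|).
  move=> h; apply: (@le_trans _ _ (e1 * `|g1|)); last first.
    by rewrite ler_wpM2l ?(ltW e10) // lerDl.
  by rewrite g1E -/A [leLHS]normrM [`|A * L * tau|]normrM [leRHS]mulrCA ler_wpM2l.
have N1E : t.1.+1%:R = t.1%:R + 1 :> R by rewrite natr1.
move: hS; rewrite !ge_max => /and3P[hS1 hS2 hS3].
have N0 : 0 < t.1%:R :> R by apply: lt_le_trans hS2.
have l0 : 0 < l by apply: lt_le_trans lo; rewrite invr_gt0 exprn_gt0.
(* Below the threshold the basis polynomial is 1 + O(1/N). *)
have [thS|thL] := leP (`|offset t| * (t.1%:R * t.1%:R)) 1.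
  apply: nearest_case.
  have thN : `|offset t| * t.1%:R <= t.1%:R^-1.
    by rewrite -div1r ler_pdivlMr // -mulrA.
  have th_eta : `|offset t| < eta.
    apply: (@le_lt_trans _ _ (t.1%:R^-1)).
      by apply: le_trans thN; rewrite ler_peMr // (le_trans _ hS2) // ler1n.
    rewrite -[ltLHS]div1r ltr_pdivrMr // mulrC.
    apply: lt_le_trans (_ : 2 <= _); first by rewrite ltr1n.
    by rewrite -ler_pdivrMr.
  have {}heta := heta th_eta.
  have [n1 n2] := small_offset t.1%:R _ e2 e20 hS2 hS1 (normr_ge0 (offset t)) thS.
  rewrite -N1E in n1 n2.
  have hl : `|l - 1| <= e2 by apply: le_trans (near1 n1) n2.
  apply: le_trans (bracket_near _ _ _ _ e2h hl hr heta) _.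
  by rewrite ler_wpM2r // mulrC -ler_pdivlMr.
(* Above it, l <= |C(x, N+1)| (N+1) C(N,m) N^2, and A is b(m) / C(N,m). *)
apply: (@le_trans _ _ (e1 * `|g2|)); last by rewrite ler_wpM2l ?(ltW e10) // lerDr.
pose bw := bweight p q t.1 (node t).
pose Cb : R := 'C(t.1, node t)%:R.
have Cb0 : 0 < Cb by rewrite ltr0n bin_gt0.
have bw0 : 0 <= bw by rewrite bweight_ge0 ?ltW.
have AE : `|A| = bw / Cb.
  rewrite /A /bw /bweight normrM !normrX normrN !gtr0_norm //.
  by rewrite -/Cb; field; rewrite gt_eqF.
have bracket : `|l * r - tau| <= l * (2 + K * (t.1.+1%:R * t.1.+1%:R)).
  apply: le_trans (ler_normB _ _) _; rewrite normrM (gtr0_norm l0) mulrDr lerD //.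
    rewrite ler_pM2l // (norm_le_close _ 1) // (le_trans hr) // (le_trans e2h) //.
    by rewrite invf_le1 // ler1n.
  apply: le_trans hK _; rewrite mulrCA -[leLHS]mulr1 ler_pM2l //.
  by rewrite -ler_pdivrMr ?mulr_gt0 // div1r -expr2.
have lX : l <= `|X| * (t.1.+1%:R * Cb) * (t.1%:R * t.1%:R).
  rewrite XE mulrAC -[leLHS]mul1r ler_pM2r //.
  exact: ltW.
have Xg2 : `|X| <= 2 * `|g2|.
  have hQ2 : `|Q| <= 2 by have := norm_le_close _ _ hQ.
  have hc : `|c| <= 1.
    by apply: dist_le1 => //; rewrite ltW //= -pq1 lerDr ltW.
  have gen (g u v : R) : `|u| <= 1 -> `|v| <= 2 -> `|g * u * v| <= 2 * `|g|.
    move=> u1 v2; rewrite !normrM mulrC; apply: ler_pM => //.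
    by rewrite ler_piMr.
  by rewrite Xeq; apply: gen => //; rewrite normrX exprn_ile1.
set F := 2 + K * _ in bracket hP.
have F0 : 0 <= F by rewrite addr_ge0 // mulr_ge0 // ltW.
rewrite [leLHS]normrM [`|A * L|]normrM AE.
apply: (@le_trans _ _ (bw / Cb * `|L| * (`|X| * (t.1.+1%:R * Cb) * (t.1%:R * t.1%:R) * F))).
  apply: ler_wpM2l; first by rewrite mulr_ge0 // divr_ge0 // ltW.
  by apply: le_trans bracket _; rewrite ler_wpM2r.
have -> : bw / Cb * `|L| * (`|X| * (t.1.+1%:R * Cb) * (t.1%:R * t.1%:R) * F) =
  (bw * (`|L| * (t.1%:R * t.1%:R * t.1.+1%:R * F))) * `|X|.
  by field; rewrite gt_eqF.
have {}hP : bw * (`|L| * (t.1%:R * t.1%:R * t.1.+1%:R * F)) <= e1 / 2.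
  have gen (w u v : R) : 0 <= w -> w * (`|u| * v) <= `|w * (u * v)|.
    move=> w0; rewrite !normrM (ger0_norm w0) ler_wpM2l // ler_wpM2l //.
    exact: ler_norm.
  by apply: le_trans hP; apply: gen.
apply: le_trans (ler_wpM2r (normr_ge0 _) hP) _.
apply: le_trans (ler_wpM2l _ Xg2) _; first by rewrite divr_ge0 // ltW.
by rewrite le_eqVlt; apply/orP; left; apply/eqP; field.
Qed.
End TwoTermExpansion.

Theorem mainTheorem11 (R : realType) (p q : R)
    (hp : 0 < p < 1) (hq : 0 < q < 1) (hpq : p + q = 1)
    (C a b delta : R) (ha : 0 < a) (hb : b < 1) (hdelta : 0 < delta)
    (e : R) (he : 0 < e) :
  \forall N \near \oo, forall (n : nat) (j : int) (y : R),
    -1 <= j -> n%:Z = N%:Z - j ->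
    `|n%:R / N%:R - 1| <= C * (1 / N%:R) ->
    a <= y <= b -> delta <= `|y - q| ->
    approx_sum e
      (krawtchouk p q N n (y * N%:R))
      (binomR N%:R j * (- p) ^ (N%:Z - j) * (q / p) `^ (N%:R * y)
         * cos (N%:R * pi * y) * (1 - y / q) ^ j)
      (binomR (N%:R * y) (N%:Z - j) * ((1 - y) / (q - y)) ^ (j + 1)).
Proof.
have [p0 _] := andP hp; have [q0 _] := andP hq.
pose D : set R := [set y | a <= y <= b /\ delta <= `|y - q|].
have D0b y : D y -> 0 <= y <= b.
  by move=> [/andP[ay ->] _]; rewrite andbT (le_trans _ ay) // ltW.
have Dq y : D y -> delta <= `|y - q| by case.
(* Only finitely many j are compatible with the bound on n/N. *)
have [J CJ] : exists J : nat, C < J%:R.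
  by exists (Num.truncn `|C|).+1; rewrite (le_lt_trans (ler_norm C)) // truncnS_gt.
have terms : \forall t \near uniformly D, forall i : 'I_J,
    approx_sum e (krawtchouk p q t.1 (t.1 - i) (t.2 * t.1%:R))
      (oscillating_term p q i t) (saddle_term q i t).
  apply: filter_forall => i.
  exact: krawtchouk_two_terms p0 q0 hpq hdelta D0b hb Dq i e he.
rewrite nearE_uniformly in terms.
apply: filterS2 terms (nbhs_infty_gt 0) => N terms N0 n j y j1 nE hn yab yq.
have Nr : 0 < N%:R :> R by rewrite ltr0n.
case: j => [i|[|i]] in j1 nE *; last by [].
  have iN : (i <= N)%N by clear -nE; lia.
  have nE' : n = (N - i)%N by clear -nE; lia.
  have iJ : (i < J)%N.
    rewrite -(ltr_nat R); apply: le_lt_trans CJ.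
    move: hn; rewrite mulrA mulr1 nE' natrB //.
    have -> : (N%:R - i%:R) / N%:R - 1 = - (i%:R / N%:R) :> R by field; rewrite gt_eqF.
    by rewrite normrN ger0_norm ?divr_ge0 // ler_pM2r ?invr_gt0.
  have := terms y (conj yab yq) (Ordinal iJ).
  rewrite /oscillating_term /saddle_term /= -nE'.
  have -> : N%:Z - i%:Z = n%:Z by rewrite nE.
  have -> : i%:Z + 1 = i.+1%:Z by rewrite -addn1.
  by rewrite -!exprnP binomR_nat.
have nE' : n = N.+1 by move: nE; rewrite NegzE; clear; lia.
rewrite nE' krawtchouk_above_degree //.
exists 0, 0; split; rewrite ?normr0 ?(ltW he) //.
have -> : binomR N%:R (Negz 0) = 0 :> R by [].
have -> : N%:Z - Negz 0 = N.+1%:Z by rewrite NegzE; clear; lia.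
have -> : Negz 0 + 1 = 0 by rewrite NegzE.
by rewrite !mul0r add0r addr0 expr0z !mulr1 [y * _]mulrC.
Qed.
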